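(* Let $K$ be an algebraically closed field. For any integers $h, e \ge 2$ with $(h,e) \neq (2,2)$ and for any integer $p \ge 5$, there exist a polynomial ring $R$ over $K$ (in finitely many variables) and a homogeneous unmixed ideal $I_{h,e,p} \subset R$ of height $h$ and multiplicity $e(R/I_{h,e,p}) = e$ such that $\sqrt{I_{h,e,p}}$ is a linear prime and $\operatorname{pd}(R/I_{h,e,p}) \ge p$.
   Context: Polynomial rings over $K$ are standard graded. $\operatorname{pd}$ denotes projective dimension over $R$, and $e(R/I)$ denotes the Hilbert–Samuel multiplicity of the graded ring $R/I$ (with respect to the graded maximal ideal). An ideal $I$ is unmixed if all associated primes of $R/I$ have the same height (equal to the height of $I$). A linear prime is a prime ideal generated by linear forms. *)

(* Defs.v *)
From HB Require Import structures.
From mathcomp Require Import all_boot all_order all_algebra.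
From mathcomp Require Import generic_quotient ring_quotient boolp mpoly.

Set Implicit Arguments.
Unset Strict Implicit.
Unset Printing Implicit Defensive.

Import Order.TTheory GRing.Theory Num.Theory.
Local Open Scope ring_scope.
Local Open Scope quotient_scope.

(* Submodules are Prop-valued, so that primes, radicals, etc. need not be
   decidable; quotients go through the classical reflection [< _ >].          *)

Record submodule (R : comNzRingType) (M : lmodType R) := Submodule {
  submodule_pred :> M -> Prop;
  submodule0 : submodule_pred 0;
  submoduleP : forall (a : R) (x y : M),
    submodule_pred x -> submodule_pred y -> submodule_pred (a *: x + y)
}.

Definition ideal (R : comNzRingType) := submodule (R^o : lmodType R).

Section QuotientModule.
Variables (R : comNzRingType) (M : lmodType R) (N : submodule M).

Definition submodule_mem : {pred M} := fun x => `[< N x >].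

Fact submodule_mem_closed : submod_closed submodule_mem.
Proof.
split=> [|a x y]; rewrite !unfold_in; first exact/asboolP/submodule0.
by move=> /asboolP Nx /asboolP Ny; apply/asboolP/submoduleP.
Qed.

HB.instance Definition _ :=
  GRing.isZmodClosed.Build M submodule_mem
    (GRing.submod_closedB submodule_mem_closed).

Definition quotmod : Type := Quotient.quot submodule_mem.
HB.instance Definition _ := GRing.Zmodule.on quotmod.

Definition quotmod_pi (x : M) : quotmod := \pi_(Quotient.quot submodule_mem) x.

Lemma quotmod_pi_eq x y : quotmod_pi x = quotmod_pi y <-> N (x - y).
Proof.
rewrite /quotmod_pi; split.
  by move=> /eqP; rewrite -Quotient.idealrBE => /asboolP.
by move=> Nxy; apply/eqP; rewrite -Quotient.idealrBE; apply/asboolP.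
Qed.

Lemma quotmod_piD x y : quotmod_pi (x + y) = quotmod_pi x + quotmod_pi y.
Proof. exact: (raddfD (\pi_(Quotient.quot submodule_mem))). Qed.

Lemma quotmod_reprK (u : quotmod) :
  quotmod_pi (repr (u : Quotient.quot submodule_mem)) = u.
Proof. exact: reprK. Qed.

Definition quotmod_scale (a : R) (u : quotmod) : quotmod :=
  quotmod_pi (a *: repr (u : Quotient.quot submodule_mem)).

Lemma quotmod_scale_pi a x : quotmod_scale a (quotmod_pi x) = quotmod_pi (a *: x).
Proof.
apply/quotmod_pi_eq; rewrite -scalerBr -[_ *: _]addr0.
apply: submoduleP (submodule0 N).
by apply/quotmod_pi_eq; rewrite quotmod_reprK.
Qed.

Fact quotmod_scaleA a b u :
  quotmod_scale a (quotmod_scale b u) = quotmod_scale (a * b) u.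
Proof. by rewrite -[u]quotmod_reprK !quotmod_scale_pi scalerA. Qed.

Fact quotmod_scale1 : left_id 1 quotmod_scale.
Proof. by move=> u; rewrite -[u]quotmod_reprK quotmod_scale_pi scale1r. Qed.

Fact quotmod_scaleDr : right_distributive quotmod_scale +%R.
Proof.
move=> a u v; rewrite -[u]quotmod_reprK -[v]quotmod_reprK.
by rewrite -quotmod_piD !quotmod_scale_pi scalerDr quotmod_piD.
Qed.

Fact quotmod_scaleDl u : {morph quotmod_scale^~ u : a b / a + b}.
Proof.
by move=> a b; rewrite -[u]quotmod_reprK !quotmod_scale_pi scalerDl quotmod_piD.
Qed.

HB.instance Definition _ := GRing.Zmodule_isLmodule.Build R quotmod
  quotmod_scaleA quotmod_scale1 quotmod_scaleDr quotmod_scaleDl.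

End QuotientModule.

Section CommutativeAlgebra.
Variable R : comNzRingType.

Definition included (T : Type) (A B : T -> Prop) := forall x, A x -> B x.
Definition strictly_included (T : Type) (A B : T -> Prop) :=
  included A B /\ ~ included B A.

Definition quot_ring_mod (I : ideal R) : lmodType R := quotmod I.

Section Generation.
Variable S : R -> Prop.
Definition generated_pred (x : R^o) : Prop :=
  forall J : ideal R, included S J -> J x.
Fact generated0 : generated_pred 0.
Proof. by move=> J _; apply: submodule0. Qed.
Fact generatedP (a : R) (x y : R^o) :
  generated_pred x -> generated_pred y -> generated_pred (a *: x + y).
Proof. by move=> Sx Sy J SJ; apply: submoduleP; [apply: Sx|apply: Sy]. Qed.
Definition generated : ideal R := Submodule generated0 generatedP.
End Generation.

Definition ideal_sum (I J : ideal R) : ideal R :=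
  generated (fun x => I x \/ J x).

Definition ideal_prod (I J : ideal R) : ideal R :=
  generated (fun x => exists a b, [/\ I a, J b & x = a * b]).

Definition unit_ideal : ideal R := generated (fun _ => True).

Definition ideal_exp (I : ideal R) (t : nat) : ideal R :=
  iter t (ideal_prod I) unit_ideal.

Section Radical.
Variable I : ideal R.
Definition radical_pred (x : R^o) : Prop := exists k : nat, I ((x : R) ^+ k).

Lemma ideal_mulr (a x : R) : I x -> I (a * x).
Proof. by move=> Ix; rewrite -[_ * _]addr0; apply: submoduleP (submodule0 I). Qed.

Fact radical0 : radical_pred 0.
Proof. by exists 1%N; rewrite expr1; apply: submodule0. Qed.

Fact radicalP (a : R) (x y : R^o) :
  radical_pred x -> radical_pred y -> radical_pred (a *: x + y).
Proof.
case=> k Ix [l Iy]; exists (k + l)%N.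
rewrite exprDn; elim/big_rec: _ => [|i z _ Iz]; first exact: submodule0.
suff Ii : I (((a * x : R) ^+ (k + l - i) * (y : R) ^+ i) *+ 'C(k + l, i)).
  by rewrite -[_ *+ _]mul1r; apply: submoduleP.
rewrite -mulr_natl; apply: ideal_mulr.
case: (leqP l i) => [li|/ltnW il].
  by apply: ideal_mulr; rewrite -(subnK li) exprD; apply: ideal_mulr.
rewrite -addnBA // addnC exprD mulrC; apply: ideal_mulr; apply: ideal_mulr.
by rewrite exprMn; apply: ideal_mulr.
Qed.

Definition radical : ideal R := Submodule radical0 radicalP.
End Radical.

Definition prime_ideal (P : ideal R) : Prop :=
  ~ P 1 /\ forall a b : R, P (a * b) -> P a \/ P b.

Definition prime_chain (C : nat -> ideal R) (c : nat) : Prop :=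
  (forall i, (i <= c)%N -> prime_ideal (C i)) /\
  (forall i, (i < c)%N -> strictly_included (C i) (C i.+1)).

Definition height_ge (I : ideal R) (c : nat) : Prop :=
  forall P : ideal R, prime_ideal P -> included I P ->
    exists C, prime_chain C c /\ (forall x, C c x <-> P x).

Definition has_height (I : ideal R) (c : nat) : Prop :=
  height_ge I c /\ ~ height_ge I c.+1.

(* Krull dimension of R/I: primes of R/I are the primes of R containing I.     *)
Definition quot_dim_ge (I : ideal R) (d : nat) : Prop :=
  exists C, prime_chain C d /\ included I (C 0%N).

Definition has_quot_dim (I : ideal R) (d : nat) : Prop :=
  quot_dim_ge I d /\ ~ quot_dim_ge I d.+1.

Definition associated_prime (M : lmodType R) (P : ideal R) : Prop :=
  prime_ideal P /\ exists x : M, forall a : R, P a <-> a *: x = 0.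

Definition unmixed (I : ideal R) : Prop :=
  exists c, has_height I c /\
    forall P, associated_prime (quot_ring_mod I) P -> has_height P c.

Definition length_ge (M : lmodType R) (l : nat) : Prop :=
  exists C : nat -> submodule M,
    forall i, (i < l)%N -> strictly_included (C i) (C i.+1).

Definition has_length (M : lmodType R) (l : nat) : Prop :=
  length_ge M l /\ ~ length_ge M l.+1.

Definition projective (P : lmodType R) : Prop :=
  forall (M N : lmodType R) (g : {linear M -> N}) (f : {linear P -> N}),
    (forall y, exists x, g x = y) ->
    exists f' : {linear P -> M}, forall x, g (f' x) = f x.

(* M has a projective resolution 0 -> F_d -> ... -> F_0 -> M -> 0.             *)
Definition has_projective_resolution (M : lmodType R) (d : nat) : Prop :=
  exists (F : nat -> lmodType R) (dif : forall i, {linear F i.+1 -> F i})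
         (aug : {linear F 0%N -> M}),
    [/\ forall i, projective (F i),
        forall y, exists x, aug x = y,
        forall x, aug x = 0 <-> exists y, dif 0%N y = x,
        forall i x, dif i x = 0 <-> exists y, dif i.+1 y = x
      & forall i, (d < i)%N -> forall x : F i, x = 0].

Definition pd_ge (M : lmodType R) (p : nat) : Prop :=
  forall d, has_projective_resolution M d -> (p <= d)%N.

End CommutativeAlgebra.

Section PolynomialRing.
Variables (K : fieldType) (n : nat).
Local Notation R := {mpoly K[n]}.

Definition homogeneous_ideal (I : ideal R) : Prop :=
  forall (f : R) (d : nat), I f -> I (pihomog mdeg d f).

Definition linear_prime (P : ideal R) : Prop :=
  prime_ideal P /\
  exists S : R -> Prop,
    (forall f, S f -> f \is 1.-homog) /\ (forall f, P f <-> generated S f).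

Definition irrelevant_ideal : ideal R :=
  generated (fun f : R => exists i : 'I_n, f = 'X_i).

(* e(R/I) = lim_t d! * length (R/(I + m^t)) / t^d, where d = dim R/I and m is
   the irrelevant ideal.                                                      *)
Definition has_multiplicity (I : ideal R) (e : nat) : Prop :=
  exists d, has_quot_dim I d /\
    forall eps : rat, 0 < eps -> exists T : nat, forall t : nat, (T <= t)%N ->
      exists l : nat,
        has_length
          (quot_ring_mod (ideal_sum I (ideal_exp irrelevant_ideal t))) l /\
        `| d`!%:R * l%:R / t%:R ^+ d - e%:R | < eps.

End PolynomialRing.

(* Main.v *)
(** Put [A = K[y_1, y_2, z_0, .., z_(b-1)]], [f = y_1^b], [g = y_2^b] and
    [F = \sum_i z_i^c y_1^i y_2^(b-1-i)], and let [I] be the kernel of the map of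
    [A]-algebras from [A[x_0, .., x_(h-1)]] to [A[t]/(t^e)] given by
    - [x_0 -> f t], [x_1 -> g t], [x_2 -> F t] with [c = 1], if [e = 2] (so [h >= 3]);
    - [x_0 -> f t], [x_1 -> g t + F t^2] with [c = b], if [e >= 3];
    the other [x_i] being sent to [0].  The ring [R/I] lies between
    [f^(e-1) A[t]/(t^e)] and [A[t]/(t^e)]; it is thus torsion-free of rank [e] over [A],
    which makes [I] primary to [(x_0, .., x_(h-1))], of multiplicity [e].

    The depth of [R/I] is [1]: for
    [s = f^(e-2) y_1^(b-1) y_2^(b-1) \prod_i z_i^(c-1)], the element [s t^(e-1)] is not in
    [R/I], but its product with any variable of [A] is.  The class of [y_1 s t^(e-1)]
    is then a nonzero element of [(R/I)/y_1 (R/I)] killed by the [b + 2] variables of [A].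
    Passing to a syzygy module lengthens by one the regular sequence modulo which such
    an element exists, and none exists in a zero module, so [pd (R/I) >= b + 1]. *)

From HB Require Import structures.
Require Import Defs.
From mathcomp Require Import all_boot all_order all_algebra.
From mathcomp Require Import mpoly.
From mathcomp Require Import boolp zify ring lra.
From mathcomp Require finmap monalg.

Set Implicit Arguments.
Unset Strict Implicit.
Unset Printing Implicit Defensive.
Import Order.TTheory GRing.Theory Num.Theory.
Local Open Scope ring_scope.

(** * Closure properties of submodules *)

Section Submodules.
Variables (R : comNzRingType) (M : lmodType R) (Z : submodule M).

Lemma submoduleZ a x : Z x -> Z (a *: x).
Proof. by move=> Zx; rewrite -[_ *: _]addr0; apply: submoduleP (submodule0 Z). Qed.

Lemma submoduleD x y : Z x -> Z y -> Z (x + y).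
Proof. by move=> Zx Zy; rewrite -[x]scale1r; apply: submoduleP. Qed.

Lemma submoduleN x : Z x -> Z (- x).
Proof. by rewrite -scaleN1r; apply: submoduleZ. Qed.

Lemma submoduleB x y : Z x -> Z y -> Z (x - y).
Proof. by move=> Zx Zy; apply: submoduleD => //; apply: submoduleN. Qed.

Lemma submodule_sum (I : Type) (s : seq I) (P : pred I) (F : I -> M) :
  (forall i, P i -> Z (F i)) -> Z (\sum_(i <- s | P i) F i).
Proof.
by move=> ZF; elim/big_rec: _ => [|i x Pi Zx]; [apply: submodule0
  | apply: submoduleD => //; apply: ZF].
Qed.

End Submodules.

(** * Regular sequences and projective dimension *)

Section RegularSequence.
Variables (R : comNzRingType) (y : nat -> R).

(** The submodule [(y_0, .., y_(k-1)) Z], where [Z] is a predicate on an ambient module, so that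
    syzygies need not become modules of their own. *)
Definition seq_mul (M : lmodType R) (Z : M -> Prop) k (m : M) : Prop :=
  exists2 z : nat -> M, forall j, Z (z j) & m = \sum_(j < k) y j *: z j.

(** Weak regularity: the last quotient may vanish, so that zero modules qualify. *)
Definition regular_seq (M : lmodType R) (Z : M -> Prop) k : Prop :=
  forall i, (i < k)%N ->
  forall m, Z m -> seq_mul Z i (y i *: m) -> seq_mul Z i m.

(** A nonzero class in [Z/(y_0, .., y_(k-1)) Z] annihilated by [y_0, .., y_(r-1)]. *)
Definition socle_mod (M : lmodType R) (Z : M -> Prop) r k : Prop :=
  exists s, [/\ Z s, ~ seq_mul Z k s
              & forall l, (l < r)%N -> seq_mul Z k (y l *: s)].

Definition full (M : lmodType R) : M -> Prop := fun=> True.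

Fact full0 (M : lmodType R) : full (0 : M). Proof. by []. Qed.
Fact fullP (M : lmodType R) (a : R) (x z : M) :
  full x -> full z -> full (a *: x + z). Proof. by []. Qed.
Definition full_submodule (M : lmodType R) := Submodule (@full0 M) (@fullP M).

Section Closure.
Variables (M : lmodType R) (Z : submodule M).

Fact seq_mul0 k : seq_mul Z k 0.
Proof.
exists (fun=> 0) => [j|]; first exact: submodule0.
by rewrite big1 // => j _; rewrite scaler0.
Qed.

Fact seq_mulP k a u v : seq_mul Z k u -> seq_mul Z k v -> seq_mul Z k (a *: u + v).
Proof.
move=> [z Zz ->] [w Zw ->]; exists (fun j => a *: z j + w j) => [j|].
  exact: submoduleP.
rewrite scaler_sumr -big_split; apply: eq_bigr => j _ /=.
by rewrite scalerDr !scalerA mulrC.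
Qed.

Definition seq_mul_submodule k := Submodule (seq_mul0 k) (@seq_mulP k).

Lemma seq_mulS k m :
  seq_mul Z k.+1 m <-> exists2 z, Z z & seq_mul Z k (m - y k *: z).
Proof.
split=> [[z Zz ->]|[z Zz [w Zw E]]].
  exists (z k) => //; exists z => //.
  by rewrite big_ord_recr /= addrK.
exists (fun j => if j == k then z else w j) => [j|]; first by case: ifP.
rewrite big_ord_recr /= eqxx -[LHS](subrK (y k *: z)) E; congr (_ + _).
by apply: eq_bigr => j _; rewrite ltn_eqF.
Qed.

End Closure.

Section Syzygy.
Variables (M F : lmodType R) (g : {linear F -> M}).
Variables (Z : submodule M) (N : submodule F).
Hypothesis gZ : forall m, Z m <-> exists f, g f = m.
Hypothesis gN : forall f, N f <-> g f = 0.

Lemma seq_mul_lift k f : seq_mul Z k (g f) ->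
  exists2 f', seq_mul (@full F) k f' & N (f - f').
Proof.
move=> [z Zz E]; have /choice[w wE] j : exists u, g u = z j by apply/gZ.
exists (\sum_(j < k) y j *: w j); first by exists w.
apply/gN; rewrite linearB linear_sum E; apply/eqP; rewrite subr_eq0; apply/eqP.
by apply: eq_bigr => j _; rewrite linearZ wE.
Qed.

Lemma seq_mul_image k f : seq_mul (@full F) k f -> seq_mul Z k (g f).
Proof.
move=> [z _ ->]; exists (fun j => g (z j)) => [j|]; first by apply/gZ; exists (z j).
by rewrite linear_sum; apply: eq_bigr => j _; rewrite linearZ.
Qed.

Lemma seq_mul_full k f : seq_mul N k f -> seq_mul (@full F) k f.
Proof. by case=> z _ ->; exists z. Qed.

(* That is, [Tor_1 (Z, R/(y_0, .., y_(k-1))) = 0] for [Z = F/N]. *)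
Lemma seq_mul_cap k f : regular_seq Z k ->
  seq_mul (@full F) k f -> N f -> seq_mul N k f.
Proof.
elim: k f => [|k IHk] f regZ.
  by move=> [z _ ->] _; rewrite !big_ord0; apply: (seq_mul0 N).
move=> /(seq_mulS (full_submodule F))[u _ fu] Nf.
have Zgu : Z (g u) by apply/gZ; exists u.
have : seq_mul Z k (g u).
  apply: regZ => //; have /seq_mul_image := fu.
  rewrite linearB linearZ (proj1 (gN f) Nf) sub0r => /(submoduleN (Z := seq_mul_submodule Z k)).
  by rewrite opprK.
(* Trading [u] for [u - u'], which lies in [N], changes [f - y k *: u] only by an element of
   [(y_0, .., y_(k-1)) F]. *)
move=> /seq_mul_lift[u' ku' Nu]; apply/seq_mulS; exists (u - u') => //.
apply: IHk => [i ik||]; first by apply: regZ; apply: leqW.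
  rewrite scalerBr opprB addrCA addrC; apply: (submoduleD (Z := seq_mul_submodule (full_submodule F) k)) => //.
  exact: (submoduleZ (Z := seq_mul_submodule (full_submodule F) k)).
by apply: submoduleB => //; apply: submoduleZ.
Qed.

(** Dimension shifting along [0 -> N -> F -> Z -> 0]: a lift [u] of the socle element satisfies
    [y k *: u = t + v] with [t] in [N] and [v] in [(y_0, .., y_(k-1)) F], and [t] is the next socle
    element. *)
Lemma syzygy_step r k : (k < r)%N -> regular_seq (@full F) r ->
  regular_seq Z k -> socle_mod Z r k ->
  regular_seq N k.+1 /\ socle_mod N r k.+1.
Proof.
move=> kr regF regZ [s [Zs ns socs]]; split.
  move=> i; rewrite ltnS => ik f Nf fi.
  apply: seq_mul_cap => //.
    by move=> j ji; apply: regZ; apply: leq_trans ik.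
  apply: regF => //; first exact: leq_ltn_trans kr.
  exact: seq_mul_full.
have [u gu] : exists u, g u = s by apply/gZ.
have lift l : (l < r)%N -> exists2 f, seq_mul (@full F) k f & N (y l *: u - f).
  by move=> lr; apply: seq_mul_lift; rewrite linearZ gu; apply: socs.
have [v kv Nv] := lift k kr.
set t := y k *: u - v in Nv.
(* If [t - y k *: z] is in [(y_0, .., y_(k-1)) N], regularity on [F] puts [u - z] in
   [(y_0, .., y_(k-1)) F], hence [s = g (u - z)] in [(y_0, .., y_(k-1)) Z]. *)
exists t; split=> // [/seq_mulS[z Nz kz]|l lr].
  apply: ns; rewrite -gu -[g u]subr0 -(proj1 (gN z) Nz) -linearB.
  apply: seq_mul_image; apply: regF => //.
  have -> : y k *: (u - z) = (t - y k *: z) + v.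
    by rewrite /t scalerBr addrAC subrK.
  apply: (submoduleD (Z := seq_mul_submodule (full_submodule F) k)) => //.
  exact: seq_mul_full.
have [w kw Nw] := lift l lr.
(* The remainder is [y k *: w - y l *: v], which lies in both [N] and [(y_0, .., y_(k-1)) F]. *)
apply/seq_mulS; exists (y l *: u - w) => //.
apply: seq_mul_cap => //; last by apply: submoduleB; apply: submoduleZ.
rewrite /t !scalerBr opprB !scalerA [y l * _]mulrC addrC addrA subrK.
apply: (submoduleB (Z := seq_mul_submodule (full_submodule F) k)) => //;
 exact: (submoduleZ (Z := seq_mul_submodule (full_submodule F) k)).
Qed.

End Syzygy.

Section Resolution.
Variable r : nat.
Hypothesis reg_proj : forall P : lmodType R, projective P -> regular_seq (@full P) r.

Fact kernel0 (M F : lmodType R) (g : {linear F -> M}) : g 0 = 0.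
Proof. exact: linear0. Qed.
Fact kernelP (M F : lmodType R) (g : {linear F -> M}) (a : R) (u v : F) :
  g u = 0 -> g v = 0 -> g (a *: u + v) = 0.
Proof. by move=> gu gv; rewrite linearP gu gv scaler0 addr0. Qed.
Definition kernel (M F : lmodType R) (g : {linear F -> M}) : submodule F :=
  Submodule (kernel0 g) (@kernelP M F g).

(** In a resolution of length [d < r.-1], [syzygy_step] applies [d.+1] times and yields a nonzero
    class in a quotient of the last syzygy module, the image of [F d.+1 = 0]. *)
Lemma pd_ge_socle (M : lmodType R) :
  regular_seq (@full M) 1 -> socle_mod (@full M) r 1 -> pd_ge M r.-1.
Proof.
move=> regM socM d [F [dif [aug [projF augS ex0 exS F0]]]].
rewrite leqNgt; apply/negP => dr.
have step0 : (1 < r)%N by rewrite ltnNge; apply/negP; case: (r) dr => [|[]].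
have base := @syzygy_step M (F 0%N) aug (full_submodule M) (kernel aug) _ _ r 1 step0
  (reg_proj (projF _)) regM socM.
have {base} [reg0 soc0] : regular_seq (kernel aug) 2 /\ socle_mod (kernel aug) r 2.
  by apply: base => // m; split=> // _; apply: augS.
pose Z i : submodule (F i) :=
  match i with 0 => kernel aug | i.+1 => kernel (dif i) end.
have exZ i x : Z i x <-> exists z, dif i z = x by case: i x.
have main i : (i <= d)%N -> regular_seq (Z i) i.+2 /\ socle_mod (Z i) r i.+2.
  elim: i => [//|i IHi] id; have [regi soci] := IHi (ltnW id).
  apply: (@syzygy_step (F i) (F i.+1) (dif i) (Z i) (Z i.+1)) => //.
  - by rewrite -ltn_predRL; apply: leq_ltn_trans dr.
  exact: reg_proj.
have [_ [s [/exZ[z <-] ns _]]] := main d (leqnn d).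
by apply: ns; rewrite (F0 _ (ltnSn d) z) linear0; apply: (seq_mul0 (Z d)).
Qed.

End Resolution.

End RegularSequence.

(** * Free modules and their direct summands *)

Section FreeModule.
Import finmap monalg.
Variable R : comNzRingType.
Local Notation free P := (malg P R).
Local Notation fcoef := mcoeff.
Local Notation fsupp := (@msupp _ R).
Local Notation funit k a := (mkmalgU k a).

Section Eval.
Variable P : lmodType R.

Definition free_eval (g : free P) : P := \sum_(k <- fsupp g) fcoef k g *: k.

Lemma free_evalE (d : {fset P}) g : (fsupp g `<=` d)%fset ->
  free_eval g = \sum_(k <- d) fcoef k g *: k.
Proof.
move=> sub; rewrite [LHS](big_fset_incl _ sub) => //= k _ kg.
by rewrite mcoeff_outdom // scale0r.
Qed.

Fact free_eval_linear : linear free_eval.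
Proof.
move=> a u v; pose d := (fsupp u `|` fsupp v `|` fsupp (a *: u + v))%fset.
rewrite !(@free_evalE d) /d ?fsubsetUr //;
  try by rewrite (fsubset_trans _ (fsubsetUl _ _)) ?fsubsetUl ?fsubsetUr.
rewrite scaler_sumr -big_split; apply: eq_bigr => k _ /=.
by rewrite mcoeffD mcoeffZ scalerDl scalerA.
Qed.

HB.instance Definition _ :=
  GRing.isLinear.Build R (free P) P *:%R free_eval free_eval_linear.

Lemma free_evalU k : free_eval (funit k 1) = k.
Proof.
by rewrite (free_evalE msuppU_le) big_seq_fset1 mcoeffUU scale1r.
Qed.

End Eval.

Variables (y : nat -> R) (r : nat).
Hypothesis regR : regular_seq y (@full R R^o) r.

Lemma regular_seq_free (P : choiceType) : regular_seq y (@full R (free P)) r.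
Proof.
move=> i ir g _ [z _ E].
pose S := seq_mul_submodule y (full_submodule (free P)) i.
rewrite [g]monalgE; apply: (submodule_sum (Z := S)) => k _.
have [] : seq_mul y (@full R R^o) i (fcoef k g).
  apply: regR => //; exists (fun j => fcoef k (z j)) => //.
  apply: (etrans (esym (mcoeffZ _ _ _))); rewrite E raddf_sum.
  by apply: eq_bigr => j _; rewrite /= mcoeffZ.
move=> w _ ->; exists (fun j => funit k (w j)) => //.
apply/malgP => l; rewrite mcoeffU raddf_sum -sumrMnl.
by apply: eq_bigr => j _; rewrite /= mcoeffZ mcoeffU mulrnAr.
Qed.

(** A projective module is a direct summand of the free module on its own elements: [free_eval] has
    a section [s], along which regularity descends. *)
Lemma regular_seq_projective (P : lmodType R) :
  projective P -> regular_seq y (@full R P) r.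
Proof.
move=> projP.
have [|s sK] := projP _ _ (@free_eval P : {linear free P -> P}) idfun.
  by move=> u; exists (funit u 1); apply: free_evalU.
move=> i ir m _ [z _ E]; rewrite -[m]/(idfun m) -sK.
have [//||w _ ->] := @regular_seq_free P i ir (s m).
  exists (fun j => s (z j)) => //; rewrite -linearZ E linear_sum.
  by apply: eq_bigr => j _; rewrite /= linearZ.
exists (fun j => free_eval (w j)) => //.
by rewrite linear_sum; apply: eq_bigr => j _; rewrite linearZ.
Qed.

End FreeModule.

(** * Substitutions and supports of polynomials *)

Section Substitution.
Variables (K : fieldType) (n k : nat) (g : 'I_n -> {mpoly K[k]}).
Implicit Types (p q : {mpoly K[n]}) (m : 'X_{1..n}).

Definition subst : {mpoly K[n]} -> {mpoly K[k]} := mmap (@mpolyC k K) g.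
HB.instance Definition _ := GRing.RMorphism.copy subst subst.

Lemma substC c : subst c%:MP = c%:MP.
Proof. by rewrite /subst mmapC. Qed.

Lemma substZ c p : subst (c *: p) = c *: subst p.
Proof. by rewrite /subst mmapZ mul_mpolyC. Qed.

Lemma substX i : subst 'X_i = g i.
Proof. by rewrite /subst mmapX mmap1U. Qed.

Lemma substXm m : subst 'X_[m] = \prod_i g i ^+ m i.
Proof. by rewrite /subst mmapX. Qed.

Lemma substE p : subst p = \sum_(m <- msupp p) p@_m *: subst 'X_[m].
Proof. by rewrite {1}[p]mpolyE rmorph_sum; apply: eq_bigr => m _; exact: substZ. Qed.

End Substitution.

Lemma subst_comp (K : fieldType) (n k l : nat) (g : 'I_k -> {mpoly K[l]})
    (g' : 'I_n -> {mpoly K[k]}) (p : {mpoly K[n]}) :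
  subst g (subst g' p) = subst (fun i => subst g (g' i)) p.
Proof.
rewrite [in RHS]substE [subst g' p]substE rmorph_sum; apply: eq_bigr => m _.
rewrite /= substZ !substXm rmorph_prod; congr (_ *: _).
by apply: eq_bigr => i _; rewrite rmorphXn.
Qed.

Lemma eq_subst (K : fieldType) (n k : nat) (g g' : 'I_n -> {mpoly K[k]}) p :
  g =1 g' -> subst g p = subst g' p.
Proof.
move=> E; rewrite substE [RHS]substE; apply: eq_bigr => m _; congr (_ *: _).
by rewrite !substXm; apply: eq_bigr => i _; rewrite E.
Qed.

Section Support.
Variables (K : fieldType) (n : nat).
Local Notation R := {mpoly K[n]}.
Implicit Types (p q : R) (m : 'X_{1..n}).

Definition supp_in (S : 'X_{1..n} -> Prop) p := forall m, p@_m != 0 -> S m.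

Section SuppIn.
Variable S : 'X_{1..n} -> Prop.

Lemma supp_in0 : supp_in S 0.
Proof. by move=> m; rewrite mcoeff0 eqxx. Qed.

Lemma supp_inX m : S m -> supp_in S 'X_[m].
Proof. by move=> Sm m'; rewrite mcoeffX; have [<-|_] := eqVneq m m'; rewrite ?eqxx. Qed.

Lemma supp_inD p q : supp_in S p -> supp_in S q -> supp_in S (p + q).
Proof.
move=> Sp Sq m; rewrite mcoeffD; have [->|/Sp//] := eqVneq p@_m 0.
by rewrite add0r => /Sq.
Qed.

Lemma supp_inZ c p : supp_in S p -> supp_in S (c *: p).
Proof. by move=> Sp m; rewrite mcoeffZ mulf_eq0 negb_or => /andP[_ /Sp]. Qed.

Lemma supp_in_sum (I : Type) (s : seq I) (P : pred I) (F : I -> R) :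
  (forall i, P i -> supp_in S (F i)) -> supp_in S (\sum_(i <- s | P i) F i).
Proof.
by move=> SF; elim/big_rec: _ => [|i x /SF Si Sx]; [apply: supp_in0|apply: supp_inD].
Qed.

End SuppIn.

Lemma supp_inM (S1 S2 S : 'X_{1..n} -> Prop) p q :
    (forall m1 m2, S1 m1 -> S2 m2 -> S (m1 + m2)%MM) ->
  supp_in S1 p -> supp_in S2 q -> supp_in S (p * q).
Proof.
move=> SD Sp Sq m; rewrite -mcoeff_msupp => /msuppM_le /allpairsP[[m1 m2] /= [m1p m2q ->]].
by apply: SD; [apply: Sp|apply: Sq]; rewrite -mcoeff_msupp.
Qed.

(** The index [d] counts factors. This one induction gives degree bounds, weights and, for [S]
    constant in [d], properties closed under products. *)
Lemma supp_in_subst_monomial (k : nat) (S : nat -> 'X_{1..n} -> Prop)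
    (g : 'I_k -> R) (m : 'X_{1..k}) :
    S 0%N 0%MM ->
    (forall d1 d2 m1 m2, S d1 m1 -> S d2 m2 -> S (d1 + d2)%N (m1 + m2)%MM) ->
    (forall i, supp_in (S 1%N) (g i)) ->
  supp_in (S (mdeg m)) (subst g 'X_[m]).
Proof.
move=> S0 SD Sg; rewrite substXm mdegE.
elim/big_rec2: _ => [|i d p _ Sp]; first by rewrite -mpolyX0; apply: supp_inX.
apply: supp_inM Sp => [m1 m2|]; first exact: SD.
elim: (m i) => [|e IHe]; first by rewrite expr0 -mpolyX0; apply: supp_inX.
by rewrite exprS -add1n; apply: supp_inM IHe => // m1 m2; apply: SD.
Qed.

End Support.

Lemma supp_in_subst (K : fieldType) (k n : nat) (S : 'X_{1..k} -> Prop)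
    (S' : 'X_{1..n} -> Prop) (g : 'I_k -> {mpoly K[n]}) p :
    (forall m, S m -> supp_in S' (subst g 'X_[m])) ->
  supp_in S p -> supp_in S' (subst g p).
Proof.
move=> SS' Sp; rewrite substE big_seq; apply: supp_in_sum => m.
by rewrite mcoeff_msupp => /Sp/SS'; apply: supp_inZ.
Qed.

(** * Ideals of variables, and divisibility by powers of a variable *)

Section Variables.
Variables (K : fieldType) (n : nat).
Local Notation R := {mpoly K[n]}.
Implicit Types (p q : R) (m : 'X_{1..n}).

Section VariableIdeal.
Variable S : pred 'I_n.

Definition kill_vars : R -> R := subst (fun i => if S i then 0 else 'X_i).
HB.instance Definition _ := GRing.RMorphism.copy kill_vars kill_vars.

Lemma kill_varsX i : kill_vars 'X_i = if S i then 0 else 'X_i.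
Proof. exact: substX. Qed.

Lemma kill_varsXm m :
  kill_vars 'X_[m] = if [forall i, S i ==> (m i == 0%N)] then 'X_[m] else 0.
Proof.
rewrite /kill_vars substXm; case: ifPn => [/forallP Sm|].
  rewrite [RHS]mpolyXE_id; apply: eq_bigr => i _.
  by case: ifP (Sm i) => //= _ /eqP ->; rewrite !expr0.
rewrite negb_forall => /existsP[i]; rewrite negb_imply => /andP[Si mi].
by rewrite (bigD1 i) //= Si expr0n (negPf mi) mul0r.
Qed.

Fact var_ideal0 : kill_vars 0 = 0. Proof. exact: rmorph0. Qed.
Fact var_idealP (a x y : R) :
  kill_vars x = 0 -> kill_vars y = 0 -> kill_vars (a * x + y) = 0.
Proof. by move=> x0 y0; rewrite rmorphD rmorphM /= x0 y0 mulr0 addr0. Qed.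
(** The ideal generated by the variables in [S], taken as the kernel of a morphism to a domain so
    that it is visibly prime. *)
Definition var_ideal : ideal R := Submodule (M := R^o) var_ideal0 var_idealP.

Lemma var_ideal_prime : prime_ideal var_ideal.
Proof.
split=> [|a b]; first by rewrite /= rmorph1 => /eqP; rewrite oner_eq0.
by rewrite /= rmorphM => /eqP; rewrite mulf_eq0 => /orP[]/eqP; [left|right].
Qed.

Lemma var_idealX i : S i -> var_ideal 'X_i.
Proof. by rewrite /= kill_varsX => ->. Qed.

Lemma sub_kill_vars (J : ideal R) p :
  (forall i, S i -> J 'X_i) -> J (p - kill_vars p).
Proof.
move=> JX; rewrite {1}[p]mpolyE {1}/kill_vars [subst _ p]substE -sumrB.
apply: submodule_sum => m _; rewrite -scalerBr -mul_mpolyC.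
apply: (submoduleZ (Z := J)); rewrite [subst _ _]kill_varsXm; case: ifPn => [_|].
  by rewrite subrr; apply: submodule0.
rewrite negb_forall => /existsP[i]; rewrite negb_imply subr0 => /andP[Si mi].
have le1 : (U_(i) <= m)%MM by rewrite lep1mP.
by rewrite -(submK le1) mpolyXD; apply: (submoduleZ (Z := J)); apply: JX.
Qed.

Lemma var_ideal_sub (J : ideal R) :
  (forall i, S i -> J 'X_i) -> included var_ideal J.
Proof. by move=> JX p /= p0; rewrite -[p]subr0 -p0; apply: sub_kill_vars. Qed.

End VariableIdeal.

Section Order.
Variable i0 : 'I_n.

(** Divisibility by ['X_i0 ^+ e], read on coefficients. For [i0 = ord0] it expresses vanishing in
    [A[t]/(t^e)]. *)
Definition tdvd e p := forall m, (m i0 < e)%N -> p@_m = 0.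

Lemma tdvd_supp e p : tdvd e p <-> supp_in (fun m => (e <= m i0)%N) p.
Proof.
split=> H m; first by rewrite leqNgt; apply: contra => /H/eqP.
by rewrite ltnNge => me; apply/eqP/negPn/negP => /H; apply/negP.
Qed.

Lemma tdvdP e p : tdvd e p <-> exists q, p = 'X_i0 ^+ e * q.
Proof.
split=> [/tdvd_supp H|[q ->]].
  exists (\sum_(m <- msupp p) p@_m *: 'X_[m - U_(i0) *+ e]).
  rewrite {1}[p]mpolyE mulr_sumr big_seq [RHS]big_seq.
  apply: eq_bigr => m; rewrite mcoeff_msupp => /H em.
  rewrite -scalerAr mpolyXn -mpolyXD addmC submK //; apply/mnm_lepP => i.
  by rewrite mulmnE mnm1E; case: eqP => [<-|_]; rewrite ?mul1n ?mul0n.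
apply/tdvd_supp; apply: (@supp_inM K n (fun m => e <= m i0)%N (fun=> True)) => //.
  by move=> m1 m2 em _; rewrite mnmDE (leq_trans em) ?leq_addr.
by rewrite mpolyXn; apply: supp_inX; rewrite mulmnE mnm1E eqxx mul1n.
Qed.

Lemma tdvdD e p q : tdvd e p -> tdvd e q -> tdvd e (p + q).
Proof. by move=> Hp Hq m em; rewrite mcoeffD Hp ?Hq ?addr0. Qed.

Lemma tdvdN e p : tdvd e p -> tdvd e (- p).
Proof. by move=> Hp m em; rewrite mcoeffN Hp ?oppr0. Qed.

Lemma tdvdM d e p q : tdvd d p -> tdvd e q -> tdvd (d + e) (p * q).
Proof.
move=> /tdvdP[u ->] /tdvdP[v ->]; apply/tdvdP; exists (u * v).
by rewrite exprD mulrACA.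
Qed.

Lemma tdvd_mull e p q : tdvd e q -> tdvd e (p * q).
Proof. exact: (@tdvdM 0). Qed.

Lemma tdvd_weak d e p : (d <= e)%N -> tdvd e p -> tdvd d p.
Proof. by move=> de H m md; apply: H; apply: leq_trans de. Qed.

Lemma tdvdX d p k : tdvd d p -> tdvd (d * k) (p ^+ k).
Proof.
move=> H; elim: k => [|k IHk]; first by rewrite muln0.
by rewrite mulnS exprS; apply: tdvdM.
Qed.

Lemma tdvd1 p : tdvd 1 p <-> kill_vars (pred1 i0) p = 0.
Proof.
split=> [/tdvdP[q ->]|p0].
  by rewrite expr1 rmorphM /= kill_varsX /= eqxx mul0r.
move=> m; rewrite ltnS leqn0 => /eqP mi.
rewrite -[p]subr0 -p0 [X in X - _]mpolyE {1}/kill_vars [subst _ p]substE -sumrB raddf_sum.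
apply: big1 => m' _; rewrite /= -scalerBr [subst _ _]kill_varsXm mcoeffZ.
case: ifP => [_|]; first by rewrite subrr mcoeff0 mulr0.
rewrite subr0 mcoeffX; case: eqP => [->|]; last by rewrite mulr0.
by move/negP=> []; apply/forallP => i; apply/implyP => /eqP ->; rewrite mi.
Qed.

(** The variable ['X_i0] is a prime element, so its powers can be split off [q] one at a time. *)
Lemma tdvd_cancel e p q : ~ tdvd 1 p -> tdvd e (p * q) -> tdvd e q.
Proof.
move=> np; elim: e q => [//|e IHe] q pq.
have /tdvdP[u qE] := IHe q (tdvd_weak (leqnSn e) pq).
have /tdvdP[v] := pq; rewrite qE mulrCA exprSr -mulrA.
have X0 : 'X_i0 != 0 :> R.
  apply/eqP => /(congr1 (mcoeff U_(i0)%MM)); rewrite mcoeffX eqxx mcoeff0.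
  by move/eqP; rewrite oner_eq0.
move=> /(mulfI (expf_neq0 _ X0)) E; rewrite -addn1; apply: tdvdM.
  by apply/tdvdP; exists 1; rewrite mulr1.
apply/tdvd1; have : kill_vars (pred1 i0) (p * u) = 0.
  by rewrite E rmorphM /= kill_varsX /= eqxx mul0r.
by rewrite rmorphM => /eqP; rewrite mulf_eq0 => /orP[/eqP/tdvd1|/eqP].
Qed.

End Order.
End Variables.

(** * Krull dimension of polynomial rings *)

Lemma left_kernel (K : fieldType) (m n : nat) (A : 'M[K]_(m, n)) :
  (n < m)%N -> exists2 v : 'rV_m, v != 0 & v *m A = 0.
Proof.
move=> nm; have : kermx A != 0.
  rewrite kermx_eq0 /row_free neq_ltn (leq_ltn_trans _ nm) //.
  exact: rank_leq_col.
by move=> /rowV0Pn[v /sub_kermxP vA v0]; exists v.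
Qed.

Section KrullDimension.
Variables (K : fieldType) (n : nat).
Local Notation R := {mpoly K[n]}.

(* There are [s ^ (n + 1)] monomials in [x] with exponents less than [s], and their
   supports lie in a box with [(b0 * s) ^ n] points. *)
Lemma algebraic_dependence (x : 'I_n.+1 -> R) :
  exists2 Q : {mpoly K[n.+1]}, Q != 0 & subst x Q = 0.
Proof.
(* [D] exceeds the degree of each [x i], and [s] is chosen so that [(b0 * s) ^ n < s ^ n.+1]. *)
pose D := (\sum_i msize (x i)).+1.
pose b0 := (n.+1 * D)%N; pose s := (b0 ^ n).+1; pose b := (b0 * s)%N.
pose A : finType := {ffun 'I_n.+1 -> 'I_s}.
pose B : finType := {ffun 'I_n -> 'I_b}.
pose mA (a : A) : 'X_{1..n.+1} := [multinom nat_of_ord (a i) | i < n.+1].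
pose mB (a : B) : 'X_{1..n} := [multinom nat_of_ord (a i) | i < n].
have AB : (#|B| < #|A|)%N.
  rewrite !card_ffun !card_ord expnMn expnS ltn_mul2r expn_gt0 /=.
  by rewrite ltnS leqnn.
pose M := \matrix_(i < #|A|, j < #|B|)
  (subst x 'X_[mA (enum_val i)])@_(mB (enum_val j)).
have [v v0 vM] := left_kernel M AB.
have mA_inj : injective mA.
  move=> a a' /mnmP E; apply/ffunP => i; apply: val_inj.
  by have := E i; rewrite !mnmE.
exists (\sum_(i < #|A|) v 0 i *: 'X_[mA (enum_val i)]).
  case/rV0Pn: v0 => i vi; apply/eqP => /(congr1 (mcoeff (mA (enum_val i)))).
  rewrite mcoeff0 raddf_sum (bigD1 i) //= mcoeffZ mcoeffX eqxx mulr1.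
  rewrite big1 ?addr0 => [/eqP|j ji]; first by rewrite (negPf vi).
  rewrite mcoeffZ mcoeffX; case: eqP => [/mA_inj/enum_val_inj E|_].
    by rewrite E eqxx in ji.
  by rewrite mulr0.
apply/mpolyP => m; rewrite mcoeff0 rmorph_sum raddf_sum /=.
have [/forallP mb|] := boolP [forall i, m i < b]%N.
  pose a : B := [ffun i => Ordinal (mb i)].
  have := congr1 (fun w : 'rV_ _ => w 0 (enum_rank a)) vM.
  rewrite !mxE => vma; apply: etrans vma; apply: eq_bigr => i _; rewrite substZ mcoeffZ mxE enum_rankK.
  by congr (_ * mcoeff _ _); apply/mnmP => j; rewrite mnmE ffunE.
rewrite negb_forall => /existsP[j]; rewrite -leqNgt => bj.
(* Outside the box some exponent is at least [b = n.+1 * D * s], while the image of a chosen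
   monomial has degree at most [n.+1 * s.-1 * D]. *)
apply: big1 => i _; rewrite substZ mcoeffZ.
have -> : (subst x 'X_[mA (enum_val i)])@_m = 0; last by rewrite mulr0.
have deg_le : supp_in (fun m => mdeg m <= mdeg (mA (enum_val i)) * D)%N
    (subst x 'X_[mA (enum_val i)]).
  apply: (@supp_in_subst_monomial _ _ _ (fun d m => mdeg m <= d * D)%N).
  - by rewrite mdeg0.
  - by move=> *; rewrite mdegD mulnDl leq_add.
  - move=> l m'; rewrite -mcoeff_msupp mul1n => /msize_mdeg_lt lt_m'.
    by apply: leq_trans (ltnW lt_m') _; rewrite /D (bigD1 l) //= -addnS leq_addr.
apply/eqP/negPn/negP => /deg_le; apply/negP; rewrite -ltnNge.
have mj : (m j <= mdeg m)%N by rewrite mdegE (bigD1 j) //= leq_addr.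
apply: leq_trans (leq_trans bj mj); rewrite /b /b0 mulnAC ltn_mul2r /= mdegE.
have: (\sum_l mA (enum_val i) l <= \sum_(l < n.+1) s.-1)%N.
  by apply: leq_sum => l _; rewrite mnmE -ltnS.
rewrite sum_nat_const card_ord => /leq_ltn_trans; apply.
by rewrite ltn_mul2l /=.
Qed.

Lemma prime_expr_mul (S : comNzRingType) (P : ideal S) (x y : S) e :
  prime_ideal P -> ~ P x -> P (x ^+ e * y) -> P y.
Proof.
move=> [_ prP] nx; elim: e => [|e IHe]; first by rewrite mul1r.
by rewrite exprS -mulrA => /prP[/nx|/IHe].
Qed.

(** Elements [x_i] of [C (i + 1)] outside [C i], for [i <= n], are [n + 1] polynomials in [n]
    variables. Their algebraic relation, pushed up the chain, ends as a nonzero constant in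
    [C (n + 1)]. *)
Lemma prime_chain_bound (C : nat -> ideal R) c : prime_chain C c -> (c <= n)%N.
Proof.
move=> [prC incC]; rewrite leqNgt; apply/negP => nc.
have /choice[x xP] (i : 'I_n.+1) : exists x : R, C i.+1 x /\ ~ C i x.
  have [_ nsub] := incC i (leq_trans (ltn_ord i) nc).
  by apply: contrapT => nex; apply: nsub => x Cx; apply: contrapT => nx; apply: nex; exists x.
have [Q0 Q00 xQ0] := algebraic_dependence x.
(* A relation between [x_j, .., x_n] modulo [C j] yields one between [x_(j+1), .., x_n]
   modulo [C (j + 1)]: factor out the largest power of [x_j], then set [x_j] to [0]. *)
have main j : (j <= n.+1)%N -> exists Q : {mpoly K[n.+1]},
    [/\ Q != 0,
      supp_in (fun m => forall i : 'I_n.+1, (i < j)%N -> m i = 0%N) Q & C j (subst x Q)].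
  elim: j => [_|j IHj jn].
    by exists Q0; split=> //; rewrite xQ0; apply: submodule0.
  have [Q [nzQ sQ CQ]] := IHj (ltnW jn).
  pose i0 := Ordinal jn; have [Cx nCx] := xP i0.
  have bound e : `[< tdvd i0 e Q >] -> (e <= mlead Q i0)%N.
    move=> /asboolP/tdvd_supp/(_ (mlead Q)); apply.
    by rewrite mleadc_eq0.
  have ex0 : exists e, `[< tdvd i0 e Q >] by exists 0%N; apply/asboolP.
  case: (ex_maxnP ex0 bound) => e /asboolP/tdvdP[q QE] maxe.
  exists (kill_vars (pred1 i0) q); split.
  - apply/eqP => /tdvd1 q1; suff: (e.+1 <= e)%N by rewrite ltnn.
    apply: maxe; apply/asboolP; rewrite QE -(addn1 e); apply: tdvdM => //.
    by apply/tdvdP; exists 1; rewrite mulr1.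
  - have sq : supp_in (fun m => forall i : 'I_n.+1, (i < j)%N -> m i = 0%N) q.
      move=> m qm i ij; have := sQ (m + U_(i0) *+ e)%MM.
      rewrite QE mpolyXn [_ * q]mulrC addmC mcoeffMX => /(_ qm i ij).
      by rewrite mnmDE => /eqP; rewrite addn_eq0 => /andP[_ /eqP].
    apply: supp_in_subst sq => m sm; rewrite -/(kill_vars _ _) kill_varsXm.
    case: ifPn => [/forallP m0|_]; last exact: supp_in0.
    apply: supp_inX => i; rewrite ltnS leq_eqVlt => /orP[/eqP ij|/sm//].
    have ii : i = i0 by apply: val_inj.
    by move: (m0 i); rewrite /= ii eqxx => /eqP.
  have Cq : C j (subst x q).
    move: CQ; rewrite QE rmorphM rmorphXn /= substX.
    apply: prime_expr_mul nCx; apply: prC; exact: leq_trans (ltnW nc).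
  have [sub _] := incC j (leq_trans jn nc).
  rewrite -[kill_vars _ q](subKr q) rmorphB.
  apply: submoduleB; first exact: sub.
  have : var_ideal K (pred1 i0) (q - kill_vars (pred1 i0) q).
    rewrite /= rmorphB /= /kill_vars subst_comp; apply/eqP; rewrite subr_eq0; apply/eqP.
    apply: eq_subst => i; case: ifP => ii; first by rewrite rmorph0.
    by rewrite substX ii.
  move=> /tdvd1/tdvdP[w ->]; rewrite rmorphM expr1 /= substX mulrC.
  by apply: (submoduleZ (Z := C j.+1)).
have [Q [nzQ sQ CQ]] := main n.+1 (leqnn _).
have [n1 _] := prC n.+1 nc; apply: n1.
have QE : Q = (mleadc Q)%:MP.
  apply/mpolyP => m; rewrite mcoeffC.
  have zero m' : Q@_m' != 0 -> m' = 0%MM.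
    by move=> /sQ H; apply/mnmP => i; rewrite mnm0E H.
  have l0 : mlead Q = 0%MM by apply: zero; rewrite mleadc_eq0.
  case: eqP => [->|m0]; first by rewrite l0 mulr1.
  by rewrite mulr0; apply/eqP/negPn/negP => /zero.
move: CQ; rewrite QE substC => /(submoduleZ (Z := C n.+1) ((mleadc Q)^-1)%:MP).
by rewrite /GRing.scale /= -mpolyCM mulVf // mleadc_eq0.
Qed.

End KrullDimension.

(** * Height and dimension from the chain of ideals of initial variables *)

Section LinearPrimes.
Variables (K : fieldType) (n : nat).
Local Notation R := {mpoly K[n]}.

Definition initial_ideal (k : nat) : ideal R := var_ideal K (fun i : 'I_n => (i < k)%N).
Local Notation V := initial_ideal.

Lemma initial_ideal_prime k : prime_ideal (V k).
Proof. exact: var_ideal_prime. Qed.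

Lemma initial_idealX k (i : 'I_n) : V k 'X_i <-> (i < k)%N.
Proof.
split=> [|ik]; last exact: var_idealX.
rewrite /= kill_varsX; case: ifP => // _ /(congr1 (mcoeff U_(i)%MM)).
by rewrite mcoeffX eqxx mcoeff0 => /eqP; rewrite oner_eq0.
Qed.

Lemma initial_ideal_incl k l : (k <= l)%N -> included (V k) (V l).
Proof.
by move=> kl; apply: var_ideal_sub => i ik; apply/initial_idealX/(leq_trans ik).
Qed.

Lemma initial_ideal_strict k : (k < n)%N -> strictly_included (V k) (V k.+1).
Proof.
move=> kn; split=> [|H]; first exact: initial_ideal_incl.
have /H/initial_idealX : V k.+1 'X_(Ordinal kn) by apply/initial_idealX; rewrite /=.
by rewrite ltnn.
Qed.

(** Continuing the chain by [V k.+1], .., [V n] makes its length [c + (n - k)], which is at most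
    [n]. *)
Lemma prime_chain_initial_end (C : nat -> ideal R) c k : (k <= n)%N ->
  prime_chain C c -> (forall x, C c x <-> V k x) -> (c <= k)%N.
Proof.
move=> kn [prC incC] CV.
(* At [i = c] this takes [V k], which has the same elements as [C c]. *)
pose C' i := if (i < c)%N then C i else V (k + (i - c)).
have : prime_chain C' (c + (n - k)).
  split=> i ile; rewrite /C'.
    by case: ifP => ic; [apply: prC; apply: ltnW|apply: initial_ideal_prime].
  case: (ltngtP i.+1 c) => [ic|ic|ic].
  - by apply: incC; apply: ltnW.
  - rewrite subSn // addnS; apply: initial_ideal_strict.
    by lia.
  - rewrite ic subnn addn0.
    have [sub nsub] := incC i (eq_leq ic).
    rewrite ic in sub nsub; split=> [x /sub /CV//|H].
    by apply: nsub => x /CV /H.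
by move=> /prime_chain_bound; lia.
Qed.

(** Preceding the chain by the [V i] with [i < k] makes its length [k + c]. *)
Lemma prime_chain_initial_start (C : nat -> ideal R) c k : (k <= n)%N ->
  prime_chain C c -> included (V k) (C 0%N) -> (k + c <= n)%N.
Proof.
move=> kn [prC incC] VC.
pose C' i := if (i < k)%N then V i else C (i - k)%N.
apply: (@prime_chain_bound K n C'); split=> i ile; rewrite /C'.
  case: ifP => ik; first exact: initial_ideal_prime.
  by apply: prC; rewrite leq_subLR.
case: (ltngtP i.+1 k) => [ik|ik|ik].
- by apply: initial_ideal_strict; apply: leq_trans kn; apply: ltnW.
- rewrite subSn //; apply: incC.
  by rewrite ltn_subLR.
- rewrite ik subnn.
  have [sub nsub] := initial_ideal_strict (leq_trans (eq_leq ik) kn).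
  rewrite ik in sub nsub VC; split=> [x /sub /VC//|H].
  by apply: nsub => x /VC /H.
Qed.

Variables (k : nat) (Q : ideal R).
Hypotheses (kn : (k <= n)%N) (QV : included Q (V k)).
Hypothesis VQ : forall P : ideal R, prime_ideal P -> included Q P -> included (V k) P.

(** The hypotheses make [V k] the least prime over [Q]. Each prime [P] over [Q] ends the chain
    formed by the [V i] with [i < k] and [P], and no chain ending at [V k] is longer than [k]. *)
Lemma has_height_initial : has_height Q k.
Proof.
split=> [P prP QP|H].
  have VP := VQ prP QP.
  exists (fun i => if (i < k)%N then V i else P); split; last by move=> x; rewrite ltnn.
  split=> i ik; first by case: ifP => // _; apply: initial_ideal_prime.
  rewrite ik; case: (ltnP i.+1 k) => ik1.
    by apply: initial_ideal_strict; apply: leq_trans kn.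
  split=> [x /(initial_ideal_incl (ltnW ik)) /VP//|PV].
  have /VP/PV/initial_idealX : V k 'X_(Ordinal (leq_trans ik kn)) by apply/initial_idealX.
  by rewrite ltnn.
have [C [chC CV]] := H (V k) (initial_ideal_prime k) QV.
by have := prime_chain_initial_end kn chC CV; rewrite ltnn.
Qed.

Lemma has_quot_dim_initial : has_quot_dim Q (n - k).
Proof.
split.
  exists (fun i => V (k + i)); split; last by rewrite addn0.
  split=> i ik; first exact: initial_ideal_prime.
  by rewrite addnS; apply: initial_ideal_strict; lia.
move=> [C [chC QC]].
have := prime_chain_initial_start kn chC (VQ (chC.1 0%N isT) QC).
by lia.
Qed.

End LinearPrimes.

(** * Length of quotients *)

Section Length.

(** Exact lengths are never computed: a bound on all chains makes the maximum exist, and estimates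
    suffice for the limit. *)
Lemma has_length_between (R : comNzRingType) (M : lmodType R) lo hi :
  length_ge M lo -> (forall l, length_ge M l -> (l <= hi)%N) ->
  exists l, has_length M l /\ (lo <= l <= hi)%N.
Proof.
move=> Mlo Mhi.
have ex0 : exists l, `[< length_ge M l >] by exists lo; apply/asboolP.
have bound l : `[< length_ge M l >] -> (l <= hi)%N by move/asboolP/Mhi.
case: (ex_maxnP ex0 bound) => l /asboolP Ml maxl; exists l; split; last first.
  by rewrite Mhi // maxl //; apply/asboolP.
by split=> // Ml1; have := maxl l.+1 (asboolT Ml1); rewrite ltnn.
Qed.

Section Quotient.
Variables (R : comNzRingType) (J : ideal R).

Section Image.
Variable D : ideal R.
Definition image_pred (u : quot_ring_mod J) := exists2 r : R, D r & quotmod_pi J r = u.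
Fact image0 : image_pred 0.
Proof.
exists 0; first exact: submodule0.
by rewrite -[0 in LHS](subrr 0) quotmod_piD -quotmod_piD subrr /quotmod_pi raddf0.
Qed.
Fact imageP a u v : image_pred u -> image_pred v -> image_pred (a *: u + v).
Proof.
move=> [r Dr <-] [s Ds <-]; exists (a * r + s); first exact: (submoduleP (s := D)).
by rewrite quotmod_piD -(quotmod_scale_pi J).
Qed.
Definition image_submodule := Submodule image0 imageP.
End Image.

Lemma length_ge_ideal_chain (D : nat -> ideal R) l :
    included J (D 0%N) ->
    (forall i, (i < l)%N -> included (D i) (D i.+1)) ->
    (forall i, (i < l)%N -> exists x, D i.+1 x /\ ~ D i x) ->
  length_ge (quot_ring_mod J) l.
Proof.
move=> JD incD exD; exists (fun i => image_submodule (D i)) => i il; split.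
  by move=> _ [r Dr <-]; exists r => //; apply: incD.
move=> H; have [x [Dx nDx]] := exD i il.
have [|r Dr /quotmod_pi_eq Jrx] := H (quotmod_pi J x); first by exists x.
have JDi : included J (D i).
  by elim: i il {H Dx nDx Dr Jrx r} => // i IHi il y /(IHi (ltnW il)); apply: incD; apply: ltnW.
by apply: nDx; rewrite -[x](subKr r); apply: submoduleB => //; apply: JDi.
Qed.

End Quotient.

Section UpperBound.
Variables (K : fieldType) (n : nat) (J : ideal {mpoly K[n]}).
Local Notation R := {mpoly K[n]}.
Local Notation pi := (quotmod_pi J).

Let piZ (a r : R) : pi (a * r) = a *: (pi r : quot_ring_mod J).
Proof. by rewrite -(quotmod_scale_pi J). Qed.

(** Submodules are [K]-subspaces. If [l > #|T|], elements of [C i.+1] outside [C i] satisfy a linear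
    relation modulo [J]; its last term is then in the span of the earlier ones, hence in [C i]. *)
Lemma length_ge_spanning (T : finType) (v : T -> R) l :
    (forall r : R, exists c : T -> K, J (r - \sum_i c i *: v i)) ->
  length_ge (quot_ring_mod J) l -> (l <= #|T|)%N.
Proof.
move=> span [C strC]; rewrite leqNgt; apply/negP => Tl.
have monoC i j : (i <= j <= l)%N -> included (C i) (C j).
  move=> /andP[ij]; rewrite -(subnKC ij); elim: (j - i)%N => [|d IHd].
    by rewrite addn0 => _ x.
  by rewrite addnS => dl x /(IHd (ltnW dl)); apply: (strC _ dl).1.
have /choice[r rP] (i : 'I_l) : exists r : R, C i.+1 (pi r) /\ ~ C i (pi r).
  have [_ nsub] := strC i (ltn_ord i).
  apply: contrapT => nex; apply: nsub => x Cx; apply: contrapT => nx; apply: nex.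
  by exists (repr (x : Quotient.quot (submodule_mem J))); rewrite quotmod_reprK.
have /choice[c cP] := fun i => span (r i).
pose A := \matrix_(i < l, j < #|T|) c i (enum_val j).
have [w w0 wA] := left_kernel A Tl.
have Jw : J (\sum_i w 0 i *: r i).
  have -> : \sum_i w 0 i *: r i
      = \sum_i (w 0 i)%:MP * (r i - \sum_t c i t *: v t).
    apply/eqP; rewrite -subr_eq0 -sumrB.
    under eq_bigr => i _ do
      rewrite mulrBr mul_mpolyC opprB addrC subrK mul_mpolyC scaler_sumr.
    rewrite exchange_big big1 //= => t _.
    have := congr1 (fun u : 'rV_ _ => u 0 (enum_rank t)) wA; rewrite !mxE => E.
    under eq_bigr => i _ do rewrite scalerA.
    rewrite -scaler_suml -[X in X *: _](_ : 0 = _) ?scale0r // -[LHS]E.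
    by apply: eq_bigr => i _; rewrite mxE enum_rankK.
  apply: submodule_sum => i _; exact: (submoduleZ (Z := J)).
case/rV0Pn: w0 => i0 wi0.
case: (@arg_maxnP _ i0 (fun i => w 0 i != 0) (fun i : 'I_l => i) wi0) => i wi maxi.
have [_] := rP i; apply.
have piw : \sum_j (w 0 j)%:MP *: (pi (r j) : quot_ring_mod J) = 0.
  have -> : \sum_j (w 0 j)%:MP *: (pi (r j) : quot_ring_mod J) = pi (\sum_j w 0 j *: r j).
    rewrite /quotmod_pi raddf_sum; apply: eq_bigr => j _.
    by rewrite -mul_mpolyC -piZ.
  have := (quotmod_pi_eq J (\sum_i w 0 i *: r i) 0).2.
  by rewrite subr0 => ->; rewrite // /quotmod_pi raddf0.
pose S := \sum_(j < l | (j < i)%N) (w 0 j)%:MP *: (pi (r j) : quot_ring_mod J).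
have iS : (w 0 i)%:MP *: (pi (r i) : quot_ring_mod J) = - S.
  apply/eqP; rewrite -subr_eq0 opprK -piw (bigD1 i) //= eq_sym; apply/eqP.
  congr (_ + _); rewrite (bigID (fun j : 'I_l => j < i)%N) /= [X in _ + X]big1 ?addr0.
    by apply: eq_bigl => j; rewrite andb_idl // => ji; rewrite neq_ltn ji.
  move=> j /andP[]; rewrite -val_eqE /= => ne nji.
  have ij : (i < j)%N by lia.
  have [->|/maxi] := eqVneq (w 0 j) 0; first by rewrite mpolyC0 scale0r.
  by move=> /=; rewrite leqNgt ij.
have -> : pi (r i) = (- (w 0 i)^-1)%:MP *: S.
  rewrite -[LHS]scale1r -mpolyC1 -(mulVf wi) mpolyCM -scalerA iS scalerN.
  by rewrite mpolyCN scaleNr.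
apply: submoduleZ; apply: submodule_sum => j ji; apply: submoduleZ.
by have [+ _] := rP j; apply: monoC; rewrite ji ltnW.
Qed.

End UpperBound.
End Length.

(** * The multiple structure *)

Section Construction.
Variables (K : fieldType) (n' h b e c : nat).
Local Notation n := n'.+1.
Local Notation R := {mpoly K[n]}.
Local Notation y1 := ('X_(inord h) : R).
Local Notation y2 := ('X_(inord h.+1) : R).
Local Notation t := ('X_ord0 : R).

(* Homogeneity of the target, for [t] of degree [1 - b]; since a monomial [m] counts [t]
   with degree [1], its degree is [d] exactly when [mdeg m = d + b * m ord0]. *)
Definition weighted d (m : 'X_{1..n}) : Prop :=
  mdeg m = (d + b * m ord0)%N /\ forall i : 'I_n, (0 < i < h)%N -> m i = 0%N.

(* Every monomial in the image of [phi] has this property, which is closed under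
   products, while [s * t ^+ e.-1] does not have it. *)
Definition balanced (m : 'X_{1..n}) : Prop :=
  (exists2 i : 'I_n, (h.+2 <= i)%N & (c <= m i)%N) \/
  (m ord0 <= m (inord h) %/ b + m (inord h.+1) %/ b)%N.

Definition bracket : R :=
  \sum_(i < b) 'X_(inord (h.+2 + i)) ^+ c * (y1 ^+ i * y2 ^+ (b.-1 - i)).

(* The variables [x_i], [y_1], [y_2], [z_i] have indices [i], [h], [h + 1], [h + 2 + i].
   The target [A[t]/(t^e)] is encoded by letting [phi] be an endomorphism of [R], the
   variable [x_0] of the target playing the role of [t]. *)
Record twist := Twist {
  twist_image : 'I_n -> R;
  twist_nvars : n = (h + b.+2)%N;
  twist_h : (0 < h)%N;
  twist_b : (0 < b)%N;
  twist_c : (0 < c)%N;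
  twist_e : (1 < e)%N;
  twist_weighted : forall i : 'I_n, (i < h)%N -> supp_in (weighted 1) (twist_image i);
  twist_balanced : forall i : 'I_n, (i < h)%N -> supp_in balanced (twist_image i);
  twist_tdvd : forall i : 'I_n, (i < h)%N -> tdvd ord0 1 (twist_image i);
  twist_image0 : twist_image ord0 = y1 ^+ b * t;
  twist_imageV : forall i : 'I_n, (h <= i)%N -> twist_image i = 'X_i;
  twist_y2 : exists q, tdvd ord0 e (subst twist_image q
    - (y1 ^+ b) ^+ (e - 2) * y2 ^+ b * t ^+ e.-1);
  twist_bracket : exists q, tdvd ord0 e (subst twist_image q
    - (y1 ^+ b) ^+ (e - 2) * bracket * t ^+ e.-1)
}.

Variable D : twist.
Let nE := twist_nvars D.
Local Notation phi := (subst (twist_image D)).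

Let inordE k : (k < h + b.+2)%N -> (inord k : 'I_n) = k :> nat.
Proof. by move=> kn; rewrite inordK // nE. Qed.

Fact twist_ideal0 : tdvd ord0 e (phi 0).
Proof. by move=> m _; rewrite rmorph0 mcoeff0. Qed.
Fact twist_idealP (a x y : R) :
  tdvd ord0 e (phi x) -> tdvd ord0 e (phi y) -> tdvd ord0 e (phi (a * x + y)).
Proof. by move=> Hx Hy; rewrite rmorphD rmorphM; apply/tdvdD/Hy/tdvd_mull. Qed.
(** The kernel of [phi] followed by reduction modulo [t ^+ e]. *)
Definition twist_ideal : ideal R := Submodule (M := R^o) twist_ideal0 twist_idealP.
Local Notation I := twist_ideal.

Lemma twist_idealB x y : I (x - y) <-> tdvd ord0 e (phi x - phi y).
Proof. by rewrite /= rmorphB. Qed.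

(** [phi] preserves degrees once [t] has degree [1 - b], and its image avoids [x_1, .., x_(h-1)],
    hence lies in [A[t]]. *)
Lemma weighted_phi m : supp_in (weighted (mdeg m)) (phi 'X_[m]).
Proof.
apply: supp_in_subst_monomial.
- by split=> [|i _]; rewrite ?mdeg0 ?mnm0E ?muln0.
- move=> d1 d2 m1 m2 [E1 Z1] [E2 Z2]; split=> [|i Hi].
    by rewrite mdegD E1 E2 mnmDE mulnDr addnACA.
  by rewrite mnmDE Z1 ?Z2.
move=> i; case: (ltnP i h) => ih; first exact: twist_weighted.
rewrite twist_imageV //; apply: supp_inX; split=> [|j /andP[_ jh]].
  rewrite mdeg1 mnm1E; case: eqP => [i0|_]; last by rewrite muln0.
  by move: ih; rewrite i0 leqNgt (twist_h D).
by rewrite mnm1E; case: eqP => // ij; move: ih; rewrite ij leqNgt jh.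
Qed.

(** The weight of a target monomial tells which graded piece of [f] it comes from, so its
    coefficient in the image of that piece is either the one in [phi f] or [0]. *)
Lemma twist_homogeneous : homogeneous_ideal I.
Proof.
move=> f d If m me; rewrite /pihomog rmorph_sum raddf_sum /=.
have zero m' : mdeg m <> (mdeg m' + b * m ord0)%N -> (phi (f@_m' *: 'X_[m']))@_m = 0.
  move=> ne; rewrite substZ mcoeffZ.
  have [->|/weighted_phi[]//] := eqVneq (phi 'X_[m'])@_m 0; exact: mulr0.
have [dE|dE] := eqVneq (mdeg m) (d + b * m ord0)%N; last first.
  by apply: big1 => m' /eqP md; apply: zero; rewrite md; apply/eqP.
rewrite -[RHS](If m me) [phi f](_ : _ = \sum_(m' <- msupp f) phi (f@_m' *: 'X_[m'])).
  rewrite raddf_sum big_mkcond; apply: eq_bigr => m' _; case: eqP => // md /=.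
  by rewrite zero // dE => /eqP; rewrite eqn_add2r => /eqP/esym.
by rewrite {1}[f]mpolyE rmorph_sum.
Qed.

(** Setting [t] to [0] after [phi] amounts to killing [x_0, .., x_(h-1)]. *)
Lemma tdvd_phi a : tdvd ord0 1 (phi a) <-> initial_ideal K n h a.
Proof.
have E : kill_vars (fun i : 'I_n => (i < h)%N) a = kill_vars (pred1 ord0) (phi a).
  rewrite /kill_vars subst_comp; apply: eq_subst => i; case: ltnP => ih.
    by apply/esym; apply/tdvd1/twist_tdvd.
  rewrite twist_imageV // substX /=; case: eqP => // i0.
  by move: ih; rewrite i0 leqNgt (twist_h D).
by rewrite tdvd1 /= E.
Qed.

Lemma twist_ideal_tdvd1 : included I (initial_ideal K n h).
Proof. by move=> a Ia; apply/tdvd_phi; apply: tdvd_weak Ia; apply: ltnW; apply: (twist_e D). Qed.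

Lemma twist_ideal_pow a : initial_ideal K n h a -> I (a ^+ e).
Proof. by move=> /tdvd_phi Ha; have := tdvdX (k := e) Ha; rewrite mul1n -rmorphXn. Qed.

Lemma prime_twist_ideal (P : ideal R) :
  prime_ideal P -> included I P -> included (initial_ideal K n h) P.
Proof.
move=> prP IP a /twist_ideal_pow/IP Pa.
apply: contrapT => na; have := prime_expr_mul prP na (y := 1) (e := e).
by rewrite mulr1 => /(_ Pa); apply: prP.1.
Qed.

Lemma twist_radical a : radical I a <-> initial_ideal K n h a.
Proof.
split=> [[k Ia]|Va]; last by exists e; apply: twist_ideal_pow.
have [nV1 prV] := initial_ideal_prime K n h.
have := twist_ideal_tdvd1 Ia; elim: k {Ia} => [/nV1//|k IHk].
by rewrite exprS => /prV[].
Qed.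

(** That is, [I] is primary: [phi a] is prime to [t], hence cancels modulo [t ^+ e]. *)
Lemma twist_cancel a r : ~ initial_ideal K n h a -> I (a * r) -> I r.
Proof. by rewrite -tdvd_phi /= rmorphM; apply: tdvd_cancel. Qed.

Lemma has_height_twist : has_height I h.
Proof.
apply: has_height_initial.
- by rewrite nE leq_addr.
- exact: twist_ideal_tdvd1.
exact: prime_twist_ideal.
Qed.

Lemma has_quot_dim_twist : has_quot_dim I b.+2.
Proof.
have -> : b.+2 = (n - h)%N by rewrite nE addKn.
apply: has_quot_dim_initial; last exact: prime_twist_ideal.
  by rewrite nE leq_addr.
exact: twist_ideal_tdvd1.
Qed.

(** An associated prime contains [I], hence the initial ideal; by [twist_cancel] it contains nothing
    more. *)
Lemma twist_unmixed : unmixed I.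
Proof.
exists h; split=> [|P [prP [u uP]]]; first exact: has_height_twist.
pose r : R := repr (u : Quotient.quot (submodule_mem I)).
have PE a : P a <-> I (a * r).
  rewrite uP -(quotmod_reprK u) -[_ *: _]/(quotmod_scale _ _) quotmod_scale_pi.
  have := quotmod_pi_eq I (a * r) 0.
  by rewrite subr0 {2}/quotmod_pi raddf0.
have VP : included (initial_ideal K n h) P.
  apply: prime_twist_ideal => // a Ia; apply/PE.
  by rewrite mulrC; apply: (submoduleZ (Z := I)).
have PV : included P (initial_ideal K n h).
  move=> a /PE Iar; apply: contrapT => /twist_cancel/(_ Iar) Ir.
  by apply: prP.1; apply/PE; rewrite mul1r.
apply: has_height_initial => //.
  by rewrite nE leq_addr.
by move=> P' prP' PP' x /VP /PP'.
Qed.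

Lemma twist_linear_prime : linear_prime (radical I).
Proof.
split.
  have [V1 prV] := initial_ideal_prime K n h.
  split=> [/twist_radical//|x y /twist_radical/prV[]]; [left|right];
  exact/twist_radical.
exists (fun f => exists2 i : 'I_n, (i < h)%N & f = 'X_i); split.
  by move=> _ [i _ ->]; rewrite dhomogX /= mdeg1.
move=> f; split=> [/twist_radical Vf|Gf].
  by move=> J JX; apply: var_ideal_sub Vf => i ih; apply: JX; exists i.
by apply: Gf => _ [i ih ->]; apply/twist_radical/initial_idealX.
Qed.

End Construction.

(** * Projective dimension of the multiple structure *)

(** Modulo the preceding variables the ring is a domain in which the next variable is nonzero. *)
Lemma regular_seq_variables (K : fieldType) (n h r : nat) : (h + r <= n.+1)%N ->
  regular_seq (fun l => 'X_(inord (h + l)) : {mpoly K[n.+1]}) (@full _ {mpoly K[n.+1]}^o) r.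
Proof.
move=> hr i ir m _; set y := fun l => _.
pose S : pred 'I_n.+1 := fun j => (h <= j < h + i)%N.
have memS (p : {mpoly K[n.+1]}) : seq_mul y (@full _ {mpoly K[n.+1]}^o) i p <-> var_ideal K S p.
  split=> [[z _ ->]|Sp].
    apply: submodule_sum => j _; rewrite -[_ *: _]/(_ * _) mulrC.
    apply: (submoduleZ (Z := var_ideal K S)); apply: var_idealX.
    by rewrite /S inordK; have := ltn_ord j; lia.
  apply: (var_ideal_sub (J := seq_mul_submodule y (full_submodule {mpoly K[n.+1]}^o) i)) Sp.
  move=> j /andP[hj ji].
  exists (fun l => if l == (j - h)%N then 1 else 0) => //.
  have jl : (j - h < i)%N by lia.
  rewrite (bigD1 (Ordinal jl)) //= eqxx big1 ?addr0 => [|l lj].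
    by rewrite /y /GRing.scale /= mulr1; congr ('X_ _); apply: val_inj; rewrite /= inordK; lia.
  by rewrite -[_ == _]/(l == Ordinal jl) (negPf lj) scaler0.
move=> /memS; rewrite -[_ *: _]/(_ * _) => /(var_ideal_prime K S).2[] yS; apply/memS => //.
move: yS; rewrite /= kill_varsX /S inordK; last by lia.
rewrite ltnn andbF => /(congr1 (mcoeff U_(inord (h + i))%MM)).
by rewrite mcoeffX eqxx mcoeff0 => /eqP; rewrite oner_eq0.
Qed.

Section ProjectiveDimension.
Variables (K : fieldType) (n' h b e c : nat) (D : twist K n' h b e c).
Local Notation n := n'.+1.
Local Notation R := {mpoly K[n]}.
Local Notation y1 := ('X_(inord h) : R).
Local Notation y2 := ('X_(inord h.+1) : R).
Local Notation z i := ('X_(inord (h.+2 + i)) : R).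
Local Notation t := ('X_ord0 : R).
Local Notation phi := (subst (twist_image D)).
Local Notation I := (twist_ideal D).
Let nE := twist_nvars D.
Let b_gt0 := twist_b D.
Let e_gt1 := twist_e D.
Let c_gt0 := twist_c D.
Let h_gt0 := twist_h D.

Let phiX k : (h <= k < h + b.+2)%N -> phi 'X_(inord k) = 'X_(inord k).
Proof. by move=> kn; rewrite substX twist_imageV // inordK; lia. Qed.

(** Membership of [p * t ^+ e.-1] in the image of [R/I] in [A[t]/(t^e)]. *)
Definition top_image (p : R) := exists r, tdvd ord0 e (phi r - p * t ^+ e.-1).

Lemma top_imageD p q : top_image p -> top_image q -> top_image (p + q).
Proof.
move=> [r Hr] [s Hs]; exists (r + s).
rewrite rmorphD (_ : _ - _ = (phi r - p * t ^+ e.-1) + (phi s - q * t ^+ e.-1)).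
  exact: tdvdD.
by rewrite mulrDl opprD addrACA.
Qed.

Lemma top_imageM w p : phi w = w -> top_image p -> top_image (w * p).
Proof.
move=> ww [r Hr]; exists (w * r); rewrite rmorphM /= ww -mulrA -mulrBr.
exact: tdvd_mull.
Qed.

Lemma top_imageN p : top_image p -> top_image (- p).
Proof.
by rewrite -mulN1r; apply: top_imageM; rewrite rmorphN rmorph1.
Qed.

Lemma top_image_sum (s : seq 'I_b) (P : pred 'I_b) (F : 'I_b -> R) :
  (forall i, P i -> top_image (F i)) -> top_image (\sum_(i <- s | P i) F i).
Proof.
move=> HF; elim/big_rec: _ => [|i p /HF Fi Hp]; last exact: top_imageD.
by exists 0; rewrite rmorph0 mul0r subrr => m _; rewrite mcoeff0.
Qed.

Let f := y1 ^+ b.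
Let g := y2 ^+ b.

Lemma top_image_y1 : top_image (f ^+ (e - 2) * f).
Proof.
(* In the witness [t] stands for the source variable [x_0], sent to [f * t]. *)
exists (t ^+ e.-1); rewrite rmorphXn /= substX twist_image0 exprMn -exprSr.
by rewrite (_ : (e - 2).+1 = e.-1) ?subrr => [m _|]; [rewrite mcoeff0|lia].
Qed.

Lemma top_image_y2 : top_image (f ^+ (e - 2) * g).
Proof. exact: (twist_y2 D). Qed.

Lemma top_image_bracket : top_image (f ^+ (e - 2) * bracket K n' h b c).
Proof. exact: (twist_bracket D). Qed.

Definition top_socle : R :=
  f ^+ (e - 2) * (y1 ^+ b.-1 * y2 ^+ b.-1 * \prod_(i < b) z i ^+ c.-1).

(** Multiplying by [y1] or [y2] creates a factor [f] or [g]. For [z i], a multiple of [bracket] is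
    used: its other terms acquire a factor [f] or [g]. *)
Lemma top_image_socle l : (l < b.+2)%N -> top_image ('X_(inord (h + l)) * top_socle).
Proof.
have fz : phi (\prod_(i < b) z i ^+ c.-1) = \prod_(i < b) z i ^+ c.-1.
  by rewrite rmorph_prod; apply: eq_bigr => i _; rewrite rmorphXn /= phiX //; have := ltn_ord i; lia.
have fy1 : phi y1 = y1 by apply: phiX; lia.
have fy2 : phi y2 = y2 by apply: phiX; lia.
have exprK (x : R) k : (0 < k)%N -> x ^+ k = x * x ^+ k.-1.
  by move=> k0; rewrite -exprS prednK.
have im_g w : phi w = w -> top_image (f ^+ (e - 2) * (w * g)).
  by rewrite mulrCA => fw; apply: top_imageM top_image_y2.
have im_f w : phi w = w -> top_image (f ^+ (e - 2) * (w * f)).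
  by rewrite mulrCA => fw; apply: top_imageM top_image_y1.
case: l => [_|[_|l]].
- rewrite addn0 mulrCA (_ : y1 * _ = y2 ^+ b.-1 * \prod_(i < b) z i ^+ c.-1 * f).
    by apply: im_f; rewrite rmorphM rmorphXn /= fy2 fz.
  by rewrite /f (exprK y1 b) //; ring.
- rewrite addn1 mulrCA (_ : y2 * _ = y1 ^+ b.-1 * \prod_(i < b) z i ^+ c.-1 * g).
    by apply: im_g; rewrite rmorphM rmorphXn /= fy1 fz.
  by rewrite /g (exprK y2 b) //; ring.
rewrite !ltnS => lb; have [i ->] : exists i : 'I_b, l = i by exists (Ordinal lb).
rewrite !addnS -!addSn mulrCA.
pose Zi := \prod_(j < b | j != i) z j ^+ c.-1.
pose w := y1 ^+ (b.-1 - i) * y2 ^+ i * Zi.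
have fZi : phi Zi = Zi.
  by rewrite rmorph_prod; apply: eq_bigr => j _; rewrite rmorphXn /= phiX //; have := ltn_ord j; lia.
have fw : phi w = w by rewrite !rmorphM !rmorphXn /= fy1 fy2 fZi.
pose T j := z j ^+ c * (y1 ^+ j * y2 ^+ (b.-1 - j)).
have ib : (i <= b.-1)%N by rewrite -ltnS prednK.
(* The left side is [w * T i]. For [j < i] the exponent of [y2] in [w * T j] is at least [b], and
   for [j > i] that of [y1] is. *)
have -> : z i * (y1 ^+ b.-1 * y2 ^+ b.-1 * \prod_(i < b) z i ^+ c.-1) =
    w * bracket K n' h b c - \sum_(j < b | j != i) w * T j.
  rewrite -mulr_sumr -mulrBr /bracket [X in w * (X - _)](bigD1 i) //= addrK (bigD1 i) //= -/Zi /w.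
  have splitK (x : R) : x ^+ b.-1 = x ^+ (b.-1 - i) * x ^+ i by rewrite -exprD subnK.
  by rewrite (exprK (z i) c) // (splitK y1) (splitK y2); ring.
rewrite mulrBr [X in _ - X]mulr_sumr; apply: top_imageD.
  by rewrite mulrCA; apply: top_imageM top_image_bracket.
apply/top_imageN/top_image_sum => j ji.
have phiz : phi (z j) = z j by apply: phiX; have := ltn_ord j; lia.
have jb := ltn_ord j; move: ji; rewrite -val_eqE /= neq_ltn => /orP[] ij.
  have -> : w * T j = (z j ^+ c * Zi * y1 ^+ (b.-1 - i + j) * y2 ^+ (i - j).-1) * g.
    have -> : g = y2 ^+ (b.-1 - j) * y2 ^+ j.+1 by rewrite -exprD; congr (_ ^+ _); lia.
    have E : (i = (i - j).-1 + j.+1 :> nat)%N by lia.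
    by rewrite /w /T {2}E !exprD; ring.
  by apply: im_g; rewrite !rmorphM !rmorphXn /= fy1 fy2 fZi phiz.
have -> : w * T j = (z j ^+ c * Zi * y1 ^+ (j - i).-1 * y2 ^+ (b.-1 - j + i)) * f.
  have -> : f = y1 ^+ (b.-1 - i) * y1 ^+ i.+1 by rewrite -exprD; congr (_ ^+ _); lia.
  have E : (j = (j - i).-1 + i.+1 :> nat)%N by lia.
  by rewrite /w /T {2}E !exprD; ring.
by apply: im_f; rewrite !rmorphM !rmorphXn /= fy1 fy2 fZi phiz.
Qed.

Lemma balanced_phi r : supp_in (balanced h b c) (phi r).
Proof.
have bal0 : balanced h b c (0%MM : 'X_{1..n}) by right; rewrite mnm0E.
have balD (m1 m2 : 'X_{1..n}) :
    balanced h b c m1 -> balanced h b c m2 -> balanced h b c (m1 + m2)%MM.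
  case=> [[i hi ci] _|H1]; first by left; exists i; rewrite // mnmDE (leq_trans ci) ?leq_addr.
  case=> [[i hi ci]|H2]; first by left; exists i; rewrite // mnmDE (leq_trans ci) ?leq_addl.
  (* Integer division by [b] is superadditive. *)
  right; rewrite !mnmDE !divnD //; lia.
apply: (@supp_in_subst _ _ _ (fun=> True)) => // m _.
apply: (@supp_in_subst_monomial _ _ _ (fun=> balanced h b c)) => // i.
case: (ltnP i h) => ih; first exact: twist_balanced.
rewrite twist_imageV //; apply: supp_inX; right; rewrite mnm1E.
by case: eqP => // i0; move: ih; rewrite i0 leqNgt h_gt0.
Qed.

(** The product [top_socle * t ^+ e.-1] is a monomial that is not balanced: its [z]-exponents are
    [c.-1], and its [y]-exponents divided by [b] give [e - 2] and [0], against [e.-1] for [t]. *)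
Lemma top_socle_notin : ~ top_image top_socle.
Proof.
pose m : 'X_{1..n} := (U_(inord h) *+ (b * (e - 2) + b.-1) + U_(inord h.+1) *+ b.-1
  + \sum_(i < b) U_(inord (h.+2 + i)) *+ c.-1 + U_(ord0) *+ e.-1)%MM.
have mE : top_socle * t ^+ e.-1 = 'X_[m].
  rewrite /m !mpolyXD -!mpolyXn -mprodXE /top_socle /f.
  under [X in _ = _ * X * _]eq_bigr => i _ do rewrite -mpolyXn.
  by rewrite exprD exprM; ring.
case=> r Hr.
have mval (j : 'I_n) : m j = ((j == h :> nat) * (b * (e - 2) + b.-1)
  + (j == h.+1 :> nat) * b.-1 + \sum_(i < b) (j == h.+2 + i :> nat) * c.-1
  + (j == 0%N :> nat) * e.-1)%N.
  have eqE l : (l < h + b.+2)%N -> (inord l == j) = (j == l :> nat).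
    by move=> ln; rewrite -val_eqE /= inordK ?nE // eq_sym.
  rewrite !mnmDE !mulmnE !mnm1E mnm_sumE !eqE; [|lia|lia].
  rewrite [ord0 == j]eq_sym; congr (_ + _ + _)%N; apply: eq_bigr => i _.
  by rewrite mulmnE mnm1E eqE //; have := ltn_ord i; lia.
have sum0 (j : 'I_n) : (j < h.+2)%N -> (\sum_(i < b) (j == h.+2 + i :> nat) * c.-1 = 0)%N.
  by move=> jh; apply: big1 => i _; rewrite (_ : (_ == _) = false) //; lia.
have m0 : m ord0 = e.-1 by rewrite mval sum0 //=; lia.
have mh : m (inord h) = (b * (e - 2) + b.-1)%N.
  by rewrite mval sum0 inordK ?nE ?eqxx //; lia.
have mh1 : m (inord h.+1) = b.-1.
  by rewrite mval sum0 inordK ?nE ?eqxx //; lia.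
(* Congruence modulo [t ^+ e] preserves this coefficient, as [m ord0 = e.-1 < e]. *)
have : (phi r)@_m != 0.
  have := Hr m; rewrite mE mcoeffB mcoeffX eqxx m0 => /(_ _)/eqP.
  by rewrite subr_eq0 => /(_ _)/eqP -> //; [rewrite oner_eq0|lia].
case/balanced_phi => [[j hj]|].
  have jb : (j - h.+2 < b)%N by have := ltn_ord j; rewrite [X in (_ < X)%N]nE; lia.
  rewrite mval (bigD1 (Ordinal jb)) //= big1 => [|i].
    rewrite (gtn_eqF (ltnW hj)) (gtn_eqF hj) (@gtn_eqF 0 j) ?(leq_trans _ hj) //.
    by rewrite !mul0n !addn0 add0n; case: eqP => _; rewrite ?mul0n ?mul1n; lia.
  by rewrite -val_eqE /=; case: eqP => //; lia.
rewrite m0 mh mh1 [(b * _)%N]mulnC divnMDl // !divn_small ?prednK //; lia.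
Qed.

Lemma pd_ge_twist : pd_ge (quot_ring_mod I) b.+1.
Proof.
pose y l : R := 'X_(inord (h + l)).
pose pi := quotmod_pi I.
have piE (x z : R) : pi x = pi z <-> I (x - z) by apply: quotmod_pi_eq.
have piZ (a x : R) : pi (a * x) = a *: (pi x : quot_ring_mod I).
  by rewrite /pi -(quotmod_scale_pi I).
have ny0 : ~ initial_ideal K n h (y 0%N).
  by move/initial_idealX; rewrite inordK ?nE ?addn0 ?ltnn //; lia.
have seq1 (u : quot_ring_mod I) :
    seq_mul y (@full _ (quot_ring_mod I)) 1 u <-> exists x, u = pi (y 0%N * x).
  split=> [[z _ ->]|[x ->]].
    by rewrite big_ord1 -(quotmod_reprK (z 0%N)) -piZ; eexists.
  by exists (fun=> pi x) => //; rewrite big_ord1 piZ.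
have pi0 : pi 0 = 0 by rewrite /pi /quotmod_pi raddf0.
have /choice[r rP] l : exists r, (l < b.+2)%N -> tdvd ord0 e (phi r - y l * top_socle * t ^+ e.-1).
  case: (ltnP l b.+2) => lb; last by exists 0.
  by have [r Hr] := top_image_socle lb; exists r.
apply: (@pd_ge_socle R y b.+2) => [P projP||].
- apply: regular_seq_projective projP.
  by apply: regular_seq_variables; rewrite nE.
- move=> i; rewrite ltnS leqn0 => /eqP -> u _ [z _]; rewrite big_ord0.
  rewrite -(quotmod_reprK u) -piZ -pi0 => /piE; rewrite subr0 => /twist_cancel-/(_ ny0) Iu.
  exists (fun=> 0) => //; rewrite big_ord0 -pi0; apply/piE.
  by rewrite subr0.
(* If [r 0] were [y 0 * x] modulo [I], cancelling [y 0] would make [x] a preimage of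
   [top_socle * t ^+ e.-1]. *)
exists (pi (r 0%N)); split=> // [/seq1[x /piE]|l lb].
  move=> /twist_idealB; rewrite rmorphM /= phiX; last by lia.
  move=> Hx; apply: top_socle_notin; exists x.
  apply: (tdvd_cancel (p := y 0%N)).
    have yE : phi (y 0%N) = y 0%N by apply: phiX; lia.
    by rewrite -yE tdvd_phi.
  rewrite (_ : _ * _ = (phi (r 0%N) - y 0%N * top_socle * t ^+ e.-1)
    - (phi (r 0%N) - y 0%N * phi x)); last by ring.
  by apply/tdvdD/tdvdN/Hx; apply: rP.
(* Both [y l * r 0] and [y 0 * r l] map to [y 0 * y l * top_socle * t ^+ e.-1]. *)
apply/seq1; exists (r l); rewrite -piZ; apply/piE/twist_idealB.
rewrite !rmorphM /= !phiX; [|lia|lia].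
rewrite -/(y l) -/(y 0%N) (_ : _ - _ = y l * (phi (r 0%N) - y 0%N * top_socle * t ^+ e.-1)
  - y 0%N * (phi (r l) - y l * top_socle * t ^+ e.-1)); last by ring.
by apply/tdvdD/tdvdN; apply: tdvd_mull; apply: rP.
Qed.

End ProjectiveDimension.

(** * Multiplicity of the multiple structure *)

Lemma mem_generated (R : comNzRingType) (S : R -> Prop) (x : R) : S x -> generated S x.
Proof. by move=> Sx J; apply. Qed.

Lemma generated_sub (R : comNzRingType) (S : R -> Prop) (J : ideal R) :
  included S J -> included (generated S) J.
Proof. by move=> SJ x; apply. Qed.

(** * Powers of the irrelevant ideal in terms of monomials *)

Section IrrelevantPowers.
Variables (K : fieldType) (n : nat).
Local Notation R := {mpoly K[n]}.
Implicit Types (m : 'X_{1..n}).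

Lemma irrelevant_expX T m : (T <= mdeg m)%N ->
  ideal_exp (irrelevant_ideal K n) T ('X_[m] : R).
Proof.
elim: T m => [|T IHT] m Tm; first exact: mem_generated.
have /forallPn[i] : ~~ [forall i, m i == 0%N].
  apply: contraTN Tm => /forallP m0; rewrite -leqNgt mdegE.
  by rewrite big1 // => i _; apply/eqP.
rewrite -lep1mP => im; rewrite -(submK im) addmC mpolyXD; apply: mem_generated.
exists 'X_i, 'X_[m - U_(i)]; split=> //; first by apply: mem_generated; exists i.
by apply: IHT; move: Tm; rewrite -{1}(submK im) mdegD mdeg1; lia.
Qed.

Section SupportIdeal.
Variable P : 'X_{1..n} -> Prop.
Hypothesis PD : forall m1 m2, P m2 -> P (m1 + m2)%MM.

Fact supp_ideal0 : supp_in P (0 : R). Proof. exact: supp_in0. Qed.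
Fact supp_idealP (a x y : R) : supp_in P x -> supp_in P y -> supp_in P (a * x + y).
Proof.
move=> Px; apply: supp_inD; apply: (@supp_inM _ _ (fun=> True)) Px => //.
by move=> m1 m2 _; apply: PD.
Qed.
Definition supp_ideal : ideal R := Submodule (M := R^o) supp_ideal0 supp_idealP.
End SupportIdeal.

Lemma supp_irrelevant_exp T (p : R) :
  ideal_exp (irrelevant_ideal K n) T p -> supp_in (fun m => T <= mdeg m)%N p.
Proof.
have degP d m1 m2 : (d <= mdeg m2 -> d <= mdeg (m1 + m2)%MM)%N.
  by rewrite mdegD => /leq_trans; apply; rewrite leq_addl.
elim: T p => [//|T IHT] p; apply: (generated_sub (J := supp_ideal (@degP T.+1))).
move=> _ [u [v [Iu /IHT Tv ->]]].
have : supp_in (fun m => 1 <= mdeg m)%N u.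
  apply: (generated_sub (J := supp_ideal (@degP 1%N))) Iu => _ [i ->].
  by apply: supp_inX; rewrite mdeg1.
move=> Tu; apply: supp_inM Tu Tv => m1 m2; rewrite mdegD; lia.
Qed.

End IrrelevantPowers.

Section Multiplicity.
Variables (K : fieldType) (n' h b e c : nat) (D : twist K n' h b e c).
Local Notation n := n'.+1.
Local Notation R := {mpoly K[n]}.
Local Notation y1 := ('X_(inord h) : R).
Local Notation t := ('X_ord0 : R).
Local Notation phi := (subst (twist_image D)).
Local Notation I := (twist_ideal D).
Let nE := twist_nvars D.
Let b_gt0 := twist_b D.
Let e_gt1 := twist_e D.
Let h_gt0 := twist_h D.
Let M := (b * e.-1)%N.

Lemma phi_fixed (m : 'X_{1..n}) : (forall i : 'I_n, (i < h)%N -> m i = 0%N) -> phi 'X_[m] = 'X_[m].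
Proof.
move=> m0; rewrite substXm [RHS]mpolyXE_id; apply: eq_bigr => i _.
by case: (ltnP i h) => ih; [rewrite m0 // !expr0 | rewrite twist_imageV].
Qed.

Section Index.
Variable T : nat.

Definition tuple_mon (s : b.+2.-tuple 'I_T.+1) : 'X_{1..n} :=
  [multinom (if (h <= i)%N then nth 0%N (map val s) (i - h) else 0%N) | i < n].

Lemma mdeg_tuple_mon s : mdeg (tuple_mon s) = (\sum_(i <- s) i)%N.
Proof.
rewrite mdegE; under eq_bigr => i _ do rewrite mnmE.
rewrite -(big_mkord xpredT (fun i => if (h <= i)%N then nth 0%N (map val s) (i - h) else 0%N)).
rewrite nE (big_cat_nat (n := h)) ?leq_addr //= [X in (X + _)%N]big_nat_cond big1 => [|i]; last first.
  by rewrite andbT => /andP[_ ih]; rewrite [(h <= i)%N]leqNgt ih.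
rewrite add0n -{1}[h]add0n big_addn addKn.
under eq_bigr => i _ do rewrite leq_addl addnK.
rewrite -[X in (_ = X)%N](big_map val xpredT id) [RHS](big_nth 0%N) size_map size_tuple.
by [].
Qed.

Lemma tuple_mon_inj : injective tuple_mon.
Proof.
move=> s s' /mnmP E; apply: eq_from_tnth => i; apply: val_inj.
have ib := ltn_ord i; have := E (inord (h + i)); rewrite !mnmE inordK ?nE; last by lia.
rewrite leq_addr addKn !(nth_map ord0) ?size_tuple //.
by rewrite -!tnth_nth.
Qed.

Lemma tuple_mon_surj (m : 'X_{1..n}) : (forall i : 'I_n, (i < h)%N -> m i = 0%N) -> (mdeg m <= T)%N ->
  exists s, tuple_mon s = m.
Proof.
move=> m0 mT; exists [tuple inord (m (inord (h + i))) | i < b.+2].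
apply/mnmP => i; rewrite mnmE; case: leqP => [hi|/m0 //].
have ib : (i - h < b.+2)%N by have := ltn_ord i; rewrite [X in (_ < X)%N]nE; lia.
rewrite (nth_map ord0) ?size_tuple // -[(i - h)%N]/(nat_of_ord (Ordinal ib)) -tnth_nth tnth_mktuple.
rewrite /= subnKC // inord_val inordK // ltnS (leq_trans _ mT) // mdegE.
by rewrite (bigD1 i) //= leq_addr.
Qed.

(** Pairs [(k, s)] standing for [t ^ k] times a monomial of [A] of degree at most [T]; their number
    has leading term [e * T ^ b.+2 / b.+2!]. *)
Definition index := {x : 'I_e * b.+2.-tuple 'I_T.+1 | (\sum_(i <- x.2) i <= T)%N}.

Lemma card_index : #|{: index}| = (e * 'C(b.+2 + T, b.+2))%N.
Proof.
have ce : #|[set: 'I_e]| = e by rewrite cardsT card_ord.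
rewrite -[X in (X * _)%N]ce card_sig -card_partial_ord_partitions -cardsX.
by apply: eq_card => x; rewrite !inE.
Qed.

Definition index_mon (x : index) : 'X_{1..n} :=
  (tuple_mon (val x).2 + U_(ord0) *+ (val x).1 + U_(inord h) *+ M)%MM.

(* A preimage of [f ^+ e.-1 * y ^ s * t ^ k], where [x] is the pair [(k, s)]. *)
Definition index_lift (x : index) : R :=
  'X_[tuple_mon (val x).2] * ((y1 ^+ b) ^+ (e.-1 - (val x).1) * t ^+ (val x).1).

(** As [x_0 ^ k] maps to [f ^ k * t ^ k], the factor [f ^ (e.-1 - k)] completes it to
    [f ^ e.-1 * t ^ k]. *)
Lemma phi_index_lift x : phi (index_lift x) = 'X_[index_mon x].
Proof.
rewrite /index_lift !rmorphM !rmorphXn /= !substX twist_image0 twist_imageV ?inordK ?nE //; last by lia.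
rewrite phi_fixed => [|i ih]; last by rewrite mnmE leqNgt ih.
rewrite /index_mon !mpolyXD -!mpolyXn /M exprM exprMn.
have := ltn_ord (val x).1 => xe.
rewrite -[in RHS](subnK (_ : (val x).1 <= e.-1)%N); last by lia.
by rewrite exprD; ring.
Qed.

End Index.

End Multiplicity.

(** * Bounds on the length of the quotient by [I] plus a power of the irrelevant ideal *)

Section LengthBounds.
Variables (K : fieldType) (n' h b e c : nat) (D : twist K n' h b e c).
Local Notation n := n'.+1.
Local Notation R := {mpoly K[n]}.
Local Notation y1 := ('X_(inord h) : R).
Local Notation t := ('X_ord0 : R).
Local Notation phi := (subst (twist_image D)).
Local Notation I := (twist_ideal D).
Local Notation J T := (ideal_sum I (ideal_exp (irrelevant_ideal K n) T)).
Let nE := twist_nvars D.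
Let b_gt0 := twist_b D.
Let e_gt1 := twist_e D.
Let h_gt0 := twist_h D.
Let M := (b * e.-1)%N.

Section Lower.
Variable T : nat.
Local Notation index := (index b e T).
Local Notation mon := (@index_mon n' h b e T).

Lemma index_mon0 x : mon x ord0 = (val x).1.
Proof.
have h0 : (inord h == ord0 :> 'I_n) = false.
  by rewrite -val_eqE /= inordK ?nE ?gtn_eqF //; lia.
by rewrite !mnmDE !mulmnE !mnm1E mnmE h0 eqxx mul1n mul0n addn0 leqNgt h_gt0.
Qed.

Lemma mdeg_index_mon x : (mdeg (mon x) < T + e + M)%N.
Proof.
rewrite !mdegD !mdegMn !mdeg1 (mdeg_tuple_mon D) !mul1n -/M.
by have := valP x; have := ltn_ord (val x).1; rewrite /=; lia.
Qed.

Lemma index_mon_inj : injective mon.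
Proof.
move=> x x' E; apply: val_inj.
have E1 : (val x).1 = (val x').1 by apply: val_inj; rewrite /= -!index_mon0 E.
move: E; rewrite /index_mon E1 => /addIm/addIm/(tuple_mon_inj D) E2.
by rewrite [LHS]surjective_pairing E1 E2 -surjective_pairing.
Qed.

Section ImageSupport.
Variable P : 'X_{1..n} -> Prop.
Hypothesis PD : forall m1 m2, P m2 -> P (m1 + m2)%MM.
Let Pe (m : 'X_{1..n}) := (m ord0 < e)%N -> P m.
Fact image_supp_ideal0 : supp_in Pe (phi 0).
Proof. by rewrite rmorph0; apply: supp_in0. Qed.
Fact image_supp_idealP (a x y : R) :
  supp_in Pe (phi x) -> supp_in Pe (phi y) -> supp_in Pe (phi (a * x + y)).
Proof.
move=> Px Py; rewrite rmorphD rmorphM; apply: supp_inD Py.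
apply: (@supp_inM _ _ (fun=> True)) Px => // m1 m2 _ H2 H12.
by apply: PD; apply: H2; move: H12; rewrite mnmDE; lia.
Qed.
Definition image_supp_ideal : ideal R :=
  Submodule (M := R^o) image_supp_ideal0 image_supp_idealP.
End ImageSupport.

(* The chain consists of the ideals of all [r] such that the monomials of [phi r] not
   divisible by [t ^+ e] are at least [w], for [w] in the image of [mon]; the monomial
   order makes them ideals, and being graded by degree makes them contain [J T1]. *)
Lemma length_ge_twist T1 : (T + e + M <= T1)%N ->
  length_ge (quot_ring_mod (J T1)) (e * 'C(b.+2 + T, b.+2)).-1.
Proof.
move=> TT1; rewrite -(card_index b e T).
pose s : seq 'X_{1..n} := sort <=%O [seq mon x | x : index].
have size_s : size s = #|{: index}| by rewrite size_sort size_map -cardE.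
have sorted_s : sorted <%O s.
  by rewrite sort_lt_sorted map_inj_uniq ?enum_uniq //; apply: index_mon_inj.
have mem_s m : m \in s -> exists x, m = mon x.
  by rewrite mem_sort => /mapP[x _ ->]; exists x.
rewrite -size_s; clearbody s; have [l lE] : exists l, size s = l by exists (size s).
(* The monomials are read in decreasing order, so that the ideals increase; [l] ideals make [l.-1]
   steps. *)
rewrite lE {size_s}; pose w i := nth 0%MM s (l.-1 - i).
have wP i : (i < l)%N -> exists x, w i = mon x.
  by move=> il; apply/mem_s/mem_nth; rewrite lE; lia.
have wS i : (i.+1 < l)%N -> (w i.+1 < w i)%O.
  by move=> il; rewrite /w (lt_sorted_ltn_nth _ sorted_s) ?inE ?lE //; lia.
have wD i (m1 m2 : 'X_{1..n}) : (w i <= m2)%O -> (w i <= (m1 + m2)%MM)%O.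
  by move=> /le_trans; apply; apply: lemc_addl.
apply: (length_ge_ideal_chain (D := fun i => image_supp_ideal (@wD i))) => [|i il|i il].
- apply: generated_sub => r [Ir|Tr].
    by move=> m + em; rewrite (Ir m em) eqxx.
  (* With no monomial at all, [w 0] is the default [0%MM], the least one. *)
  have [l0|l0] := posnP l.
    by move=> m _ _; rewrite /w nth_default ?lE ?l0 //; apply: le0m.
  (* [phi] does not lower degrees, so monomials of [phi r] have degree at least [T1], which exceeds
     that of [w 0]. *)
  have [x wx] := wP 0%N l0.
  move=> m pm em; rewrite wx; apply/ltW/lt_mdeg_ltmc.
  apply: leq_trans (leq_trans (mdeg_index_mon x) TT1) _.
  have := supp_irrelevant_exp Tr.
  move/(@supp_in_subst _ _ _ _ (fun m => T1 <= mdeg m)%N (twist_image D)); apply=> //.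
  by move=> m1 Tm1 m2 /weighted_phi[-> _]; rewrite (leq_trans Tm1) ?leq_addr.
- by move=> r Hr /= m pm em; apply: le_trans (Hr m pm em); apply/ltW/wS; lia.
have [|x wx] := wP i.+1; first by lia.
(* Its image is the single monomial [w i.+1], below [w i] and with [t]-exponent less than [e]. *)
exists (index_lift K n' h x); rewrite /= phi_index_lift -wx; split.
  by apply: supp_inX => _.
move=> /(_ (w i.+1)); rewrite mcoeffX eqxx oner_eq0 wx index_mon0 => /(_ isT (ltn_ord _)).
by rewrite -wx leNgt wS //; lia.
Qed.

End Lower.

Section Upper.
Variable T : nat.
Let J := J T.+1.

Lemma J_twist r : I r -> J r.
Proof. by move=> Ir; apply: mem_generated; left. Qed.

Lemma J_monomial m : (T < mdeg m)%N -> J 'X_[m].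
Proof. by move=> Tm; apply: mem_generated; right; apply: irrelevant_expX. Qed.

Definition box_bound (i : nat) : nat := if (i < h)%N then e else if i == h then M else T.+1.
Definition box := {dffun forall i : 'I_n, 'I_(box_bound i)}.

Lemma card_box : #|{: box}| = (e ^ h * M * T.+1 ^ b.+1)%N.
Proof.
rewrite card_dep_ffun foldrE big_map big_enum /=.
under eq_bigr => i _ do rewrite card_ord.
rewrite -(big_mkord xpredT box_bound) nE (big_cat_nat (n := h)) ?leq_addr //=.
rewrite -mulnA; congr (_ * _)%N.
  rewrite -{2}[h]subn0 -prod_nat_const_nat; apply: eq_big_nat => i /andP[_ ih].
  by rewrite /box_bound ih.
rewrite big_ltn; last by rewrite -[X in (X < _)%N]addn0 ltn_add2l.
rewrite {1}/box_bound ltnn eqxx; congr (_ * _)%N.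
have E : b.+1 = (h + b.+2 - h.+1)%N by lia.
rewrite [in RHS]E -prod_nat_const_nat; apply: eq_big_nat => i /andP[hi _].
by rewrite /box_bound ltnNge (ltnW hi) (gtn_eqF hi).
Qed.

Definition spanning (x : index b e T + box) : R :=
  match x with
  | inl x => index_lift K n' h x
  | inr x => 'X_[[multinom nat_of_ord (x i) | i < n]]
  end.

Definition spanned (r : R) :=
  exists a : index b e T + box -> K, J (r - \sum_x a x *: spanning x).

Lemma spannedD p q : spanned p -> spanned q -> spanned (p + q).
Proof.
move=> [a Ha] [d Hd]; exists (fun x => a x + d x).
under eq_bigr => x _ do rewrite scalerDl.
by rewrite big_split opprD addrACA; apply: (submoduleD (Z := J)).
Qed.

Lemma spannedZ k p : spanned p -> spanned (k *: p).
Proof.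
move=> [a Ha]; exists (fun x => k * a x).
under eq_bigr => x _ do rewrite -scalerA.
rewrite -scaler_sumr -scalerBr -mul_mpolyC.
exact: (submoduleZ (Z := J)).
Qed.

Lemma spanned_J p : J p -> spanned p.
Proof.
by move=> Jp; exists (fun=> 0); rewrite big1 ?subr0 // => x _; rewrite scale0r.
Qed.

Lemma spanned_spanning x : spanned (spanning x).
Proof.
exists (fun x' => (x' == x)%:R); rewrite (bigD1 x) //= eqxx scale1r.
rewrite big1 => [|x' /negPf ->]; last by rewrite scale0r.
by rewrite addr0 subrr; apply: (submodule0 J).
Qed.

Lemma spanned_sum (A : Type) (s : seq A) (F : A -> R) :
  (forall i, spanned (F i)) -> spanned (\sum_(i <- s) F i).
Proof.
move=> HF; elim/big_rec: _ => [|i p _ Hp]; last exact: spannedD.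
exact/spanned_J/(submodule0 J).
Qed.

(** If [m] is [m' * t ^ k] with [k < e], then [m' * f ^ (e.-1 - k) * x_0 ^ k] is a lift. It is in
    [J] when [m'] has degree above [T], and is one of the [index_lift] otherwise. *)
Lemma spanned_conductor_monomial (m : 'X_{1..n}) :
    (forall i : 'I_n, (0 < i < h)%N -> m i = 0%N) ->
  exists2 r, spanned r & tdvd ord0 e (phi r - (y1 ^+ b) ^+ e.-1 * 'X_[m]).
Proof.
move=> m0; case: (leqP e (m ord0)) => [em|me].
  exists 0; first exact/spanned_J/(submodule0 J).
  rewrite rmorph0 sub0r; apply: tdvdN; apply: tdvd_mull; apply/tdvd_supp.
  exact: supp_inX.
pose m' := (m - U_(ord0) *+ m ord0)%MM.
have mE : m = (m' + U_(ord0) *+ m ord0)%MM.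
  apply/mnmP => i; rewrite mnmDE mnmBE mulmnE mnm1E.
  by case: eqP => [<-|_]; rewrite ?mul1n ?mul0n ?subnn ?subn0 ?addn0.
have m'0 (i : 'I_n) : (i < h)%N -> m' i = 0%N.
  move=> ih; rewrite mnmBE mulmnE mnm1E; case: eqP => [<-|/eqP ne].
    by rewrite mul1n subnn.
  by rewrite mul0n subn0 m0 // ih andbT lt0n eq_sym.
pose r : R := 'X_[m'] * ((y1 ^+ b) ^+ (e.-1 - m ord0) * t ^+ m ord0).
have phir : phi r = (y1 ^+ b) ^+ e.-1 * 'X_[m].
  rewrite [in RHS]mE mpolyXD -mpolyXn /r !rmorphM !rmorphXn /= !substX twist_image0.
  rewrite twist_imageV ?inordK ?nE //; last by lia.
  rewrite (phi_fixed D) // -[in RHS](subnK (_ : m ord0 <= e.-1)%N); last by lia.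
  by rewrite exprD exprMn; ring.
exists r; last by rewrite phir subrr => m1 _; rewrite mcoeff0.
case: (leqP (mdeg m') T) => m'T; last first.
  apply: spanned_J; rewrite /r mulrC.
  by apply: (submoduleZ (Z := J)); apply: J_monomial.
have [s sm] := tuple_mon_surj D m'0 m'T.
have sT : (\sum_(i <- s) i <= T)%N by rewrite -(mdeg_tuple_mon D) sm.
have -> : r = spanning (inl (exist _ (Ordinal me, s) sT)).
  by rewrite /spanning /index_lift /= sm.
exact: spanned_spanning.
Qed.

Lemma spanned_conductor (w : R) :
    supp_in (fun m => forall i : 'I_n, (0 < i < h)%N -> m i = 0%N) w ->
  exists2 r, spanned r & tdvd ord0 e (phi r - (y1 ^+ b) ^+ e.-1 * w).
Proof.
move=> Hw; rewrite [w]mpolyE big_seq.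
elim/big_rec: _ => [|m p mw [r Sr Hr]].
  exists 0; first exact/spanned_J/(submodule0 J).
  by rewrite rmorph0 mulr0 subrr => m _; rewrite mcoeff0.
have [|s Ss Hs] := @spanned_conductor_monomial m; first by apply: Hw; rewrite -mcoeff_msupp.
exists (w@_m *: s + r); first by apply: spannedD => //; apply: spannedZ.
rewrite rmorphD /= substZ mulrDr -scalerAr opprD addrACA -scalerBr -mul_mpolyC.
by apply: tdvdD => //; apply: tdvd_mull.
Qed.

(* A monomial divisible by [y_1 ^ M], with [M = b * e.-1], is [f ^+ e.-1] times another
   one, so [spanned_conductor] applies; all others of degree at most [T], up to [I],
   lie in a box with [O(T ^ b.+1)] points. *)
Lemma spanned_monomial m : spanned 'X_[m].
Proof.
case: (leqP (mdeg m) T) => mT; last exact/spanned_J/J_monomial.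
have [/existsP[i /andP[ih ei]]|] := boolP [exists i : 'I_n, (i < h)%N && (e <= m i)%N].
  apply/spanned_J/J_twist.
  have im : (U_(i) *+ e <= m)%MM.
    by apply/mnm_lepP => j; rewrite mulmnE mnm1E; case: eqP => [<-|_]; rewrite ?mul1n.
  rewrite -(submK im) mpolyXD -mpolyXn; apply: (submoduleZ (Z := I)).
  exact/twist_ideal_pow/initial_idealX.
rewrite negb_exists => /forallP small_x.
case: (ltnP (m (inord h)) M) => mh.
  have bound (i : 'I_n) : (m i < box_bound i)%N.
    rewrite /box_bound; case: (ltnP i h) => ih; first by have := small_x i; rewrite ih -ltnNge.
    case: eqP => [ih'|_]; first by rewrite (_ : i = inord h) // -ih' inord_val.
    by rewrite ltnS (leq_trans _ mT) // mdegE (bigD1 i) //= leq_addr.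
  have -> : 'X_[m] = spanning (inr [ffun i => Ordinal (bound i)]).
    by congr 'X_[_]; apply/mnmP => i; rewrite mnmE ffunE.
  exact: spanned_spanning.
have hm : (U_(inord h) *+ M <= m)%MM.
  by apply/mnm_lepP => j; rewrite mulmnE mnm1E; case: eqP => [<-|_]; rewrite ?mul1n.
have [|r Sr Hr] := @spanned_conductor (phi 'X_[m - U_(inord h) *+ M]).
  by move=> m1 /weighted_phi[].
rewrite -['X_[m]](subrK r); apply: spannedD => //.
apply/spanned_J/J_twist/twist_idealB; rewrite -opprB; apply: tdvdN.
have -> : phi 'X_[m] = (y1 ^+ b) ^+ e.-1 * phi 'X_[m - U_(inord h) *+ M].
  rewrite -{1}(submK hm) mpolyXD -mpolyXn rmorphM rmorphXn /= substX.
  rewrite twist_imageV ?inordK ?nE //; last by lia.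
  by rewrite mulrC exprM.
exact: Hr.
Qed.

Lemma length_le_twist l : length_ge (quot_ring_mod J) l ->
  (l <= e * 'C(b.+2 + T, b.+2) + e ^ h * M * T.+1 ^ b.+1)%N.
Proof.
rewrite -card_index -card_box -card_sum; apply: (length_ge_spanning (v := spanning)) => r.
suff [a Ha] : spanned r by exists a.
rewrite [r]mpolyE; apply: spanned_sum => m.
by apply: spannedZ; apply: spanned_monomial.
Qed.

End Upper.

End LengthBounds.

(** * Leading terms of binomial coefficients and the limit *)

Section Asymptotics.

Lemma expn_add_bound c N : exists C, forall t, (0 < t)%N ->
  ((t + c) ^ N.+1 <= t ^ N.+1 + C * t ^ N)%N.
Proof.
elim: N => [|N [C HC]]; first by exists c => t _; rewrite !expn1 muln1.
exists (C + c + c * C)%N => t t0; rewrite expnS [(t ^ N.+2)%N]expnS.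
apply: leq_trans (leq_mul (leqnn _) (HC t t0)) _.
have tN : (t ^ N <= t ^ N.+1)%N by rewrite expnS leq_pmull.
have tcN : (c * C * t ^ N <= c * C * t ^ N.+1)%N by rewrite leq_mul2l tN orbT.
move: tcN; rewrite [(t ^ N.+1)%N]expnS; nia.
Qed.

Lemma ffact_bounds N m : ((m.+1) ^ N <= (N + m) ^_ N <= (m + N) ^ N)%N.
Proof.
elim: N => [|N /andP[lo hi]]; first by rewrite ffactn0 !expn0.
rewrite addSn ffactSS !expnS; apply/andP; split; apply: leq_mul => //; try lia.
apply: leq_trans hi _; case: N {lo} => [//|N].
by rewrite leq_exp2r // leq_add2l.
Qed.

(** In use [F] is [d!], [B] a binomial coefficient, [Q = t ^ d] and [P = t ^ d.-1], where
    [d = b.+2]. The constant before [P] is shared with the lower bound. *)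
Lemma scaled_upper_bound (e F B Q P C1 C2 A : nat) : (F * B <= Q + C1 * P)%N ->
  (F * (e * B + A * P) <= e * Q + (e * C1 + e * C2 + F * A + F) * P)%N.
Proof. by move=> U; have := leq_mul (leqnn e) U; rewrite !mulnDl !mulnDr; lia. Qed.

(** The summand [F] of the constant absorbs the passage from [l.+1] to [l]. *)
Lemma scaled_lower_bound (e F B Q P C1 C2 A l : nat) :
    (Q <= F * B + C2 * P)%N -> (e * B <= l.+1)%N -> (0 < P)%N ->
  (e * Q <= F * l + (e * C1 + e * C2 + F * A + F) * P)%N.
Proof.
move=> U V W; have := leq_mul (leqnn e) U; have := leq_mul (leqnn F) V.
by have := leq_mul (leqnn F) W; rewrite !mulnDl !mulnDr !mulnS; lia.
Qed.

(** After division by [t ^ N.+1] the error is at most [C / t]. *)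
Lemma ratio_close N (e C L t : nat) (eps : rat) : 0 < eps -> (0 < t)%N ->
    C%:R / eps < t%:R ->
    (L <= e * t ^ N.+1 + C * t ^ N)%N -> (e * t ^ N.+1 <= L + C * t ^ N)%N ->
  `|L%:R / t%:R ^+ N.+1 - e%:R| < eps.
Proof.
move=> eps0 t0 Ct HL HR.
have H1 : L%:R <= e%:R * t%:R ^+ N.+1 + C%:R * t%:R ^+ N :> rat.
  by rewrite -!natrX -!natrM -natrD ler_nat.
have H2 : e%:R * t%:R ^+ N.+1 <= L%:R + C%:R * t%:R ^+ N :> rat.
  by rewrite -!natrX -!natrM -natrD ler_nat.
have t0' : 0 < t%:R :> rat by rewrite ltr0n.
have tN : 0 < t%:R ^+ N.+1 :> rat by rewrite exprn_gt0.
rewrite -[e%:R](mulfK (lt0r_neq0 tN)) -mulrBl normrM normfV (gtr0_norm tN).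
rewrite ltr_pdivrMr //; apply: (@le_lt_trans _ _ (C%:R * t%:R ^+ N)).
  by rewrite ler_norml; apply/andP; split; lra.
rewrite exprS mulrA ltr_pM2r ?exprn_gt0 //.
by rewrite mulrC -ltr_pdivrMr.
Qed.

End Asymptotics.

Section TwistMultiplicity.
Variables (K : fieldType) (n' h b e c : nat) (D : twist K n' h b e c).

Lemma twist_multiplicity : has_multiplicity (twist_ideal D) e.
Proof.
exists b.+2; split=> [|eps eps0]; first exact: has_quot_dim_twist.
pose c0 := (e + b * e.-1)%N; pose A := (e ^ h * (b * e.-1))%N.
have [C1 HC1] := expn_add_bound b.+2 b.+1.
have [C2 HC2] := expn_add_bound c0 b.+1.
pose C := (e * C1 + e * C2 + (b.+2)`! * A + (b.+2)`!)%N.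
(* The first bound makes [t - c0] positive, the second makes [C / t] less than [eps]. *)
exists (maxn c0.+1 (Num.bound (C%:R / eps))) => t; rewrite geq_max => /andP[c0t bt].
have Ct : C%:R / eps < t%:R.
  have C0 : 0 <= C%:R / eps :> rat by rewrite divr_ge0 ?ler0n // ltW.
  by apply: lt_le_trans (archi_boundP C0) _; rewrite ler_nat.
have t0 : (0 < t)%N by apply: leq_ltn_trans c0t.
(* The upper bound concerns the power [T.+1], hence is used at [T = t.-1]. *)
have tE : t = t.-1.+1 by rewrite prednK.
have lo : length_ge (quot_ring_mod (ideal_sum (twist_ideal D)
    (ideal_exp (irrelevant_ideal K n'.+1) t))) (e * 'C(b.+2 + (t - c0), b.+2)).-1.
  by apply: length_ge_twist; rewrite -addnA -/c0; lia.
have hi l : length_ge (quot_ring_mod (ideal_sum (twist_ideal D)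
    (ideal_exp (irrelevant_ideal K n'.+1) t))) l ->
    (l <= e * 'C(b.+2 + t.-1, b.+2) + A * t ^ b.+1)%N.
  by rewrite {1}tE => /length_le_twist; rewrite -tE.
have [l [Hl /andP[lo_l l_hi]]] := has_length_between lo hi.
exists l; split=> //; rewrite -natrM; apply: (@ratio_close b.+1 e C) => //.
  have U : (b.+2`! * 'C(b.+2 + t.-1, b.+2) <= t ^ b.+2 + C1 * t ^ b.+1)%N.
    apply: leq_trans (HC1 t t0); rewrite mulnC bin_ffact.
    have /andP[_ /leq_trans] := ffact_bounds b.+2 t.-1; apply.
    by rewrite leq_exp2r // leq_add2r leq_pred.
  apply: leq_trans (leq_mul (leqnn _) l_hi) _.
  exact: scaled_upper_bound.
have U : (t ^ b.+2 <= b.+2`! * 'C(b.+2 + (t - c0), b.+2) + C2 * t ^ b.+1)%N.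
  have tc : (0 < t - c0)%N by rewrite subn_gt0.
  have := HC2 _ tc; rewrite subnK ?(ltnW c0t) // => /leq_trans; apply.
  apply: leq_add; last by rewrite leq_mul2l leq_exp2r // leq_subr orbT.
  rewrite mulnC bin_ffact; have /andP[+ _] := ffact_bounds b.+2 (t - c0).
  by apply: leq_trans; rewrite leq_exp2r.
apply: scaled_lower_bound U _ _; last by rewrite expn_gt0 t0.
exact: leq_trans (leqSpred _) _.
Qed.

End TwistMultiplicity.

(** * Existence of the multiple structures *)

Section Instances.
Variables (K : fieldType) (h b e c : nat).
Local Notation n' := (h + b).+1.
Local Notation n := n'.+1.
Local Notation R := {mpoly K[n]}.
Local Notation y1 := ('X_(inord h) : R).
Local Notation y2 := ('X_(inord h.+1) : R).
Local Notation t := ('X_ord0 : R).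
Local Notation F := (bracket K n' h b c).
Hypotheses (h_gt1 : (1 < h)%N) (b_gt0 : (0 < b)%N) (c_gt0 : (0 < c)%N) (e_gt1 : (1 < e)%N).

Section Image.
Variables u v : R.

(** The terms [u] and [v] carry [F * t ^+ 2] and [0] if [e >= 3], and [0] and [F * t] if [e = 2].
    For [h = 2] the first test already sends index [2], that of [y_1], to itself. *)
Definition twisted_variable (i : 'I_n) : R :=
  if (h <= i)%N then 'X_i
  else if i == 0%N :> nat then y1 ^+ b * t
  else if i == 1%N :> nat then y2 ^+ b * t + u
  else if i == 2%N :> nat then v
  else 0.

Hypotheses (u_weighted : supp_in (weighted h b 1) u) (v_weighted : supp_in (weighted h b 1) v).
Hypotheses (u_balanced : supp_in (balanced h b c) u) (v_balanced : supp_in (balanced h b c) v).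
Hypotheses (u_tdvd : tdvd ord0 2 u) (v_tdvd : tdvd ord0 1 v).

Local Notation phi := (subst twisted_variable).

Let inord0 (i : 'I_n) k : (k < n)%N -> (inord k == i) = (k == i).
Proof. by move=> kn; rewrite -val_eqE /= inordK. Qed.

Lemma corner_weighted k : (h <= k < h.+2)%N ->
  supp_in (weighted h b 1) ('X_(inord k) ^+ b * t).
Proof.
move=> hk; rewrite mpolyXn -mpolyXD; apply: supp_inX.
have kn : (k < n)%N by lia.
split=> [|i /andP[i0 ih]]; rewrite !mnmDE !mulmnE !mnm1E !inord0 //.
  by rewrite mdegD mdegMn !mdeg1 eqxx (_ : (k == _) = false) /=; lia.
rewrite (_ : (k == i) = false); last by lia.
by rewrite -val_eqE /=; case: (nat_of_ord i) i0.
Qed.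

Lemma corner_balanced k : (h <= k < h.+2)%N ->
  supp_in (balanced h b c) ('X_(inord k) ^+ b * t).
Proof.
move=> hk; rewrite mpolyXn -mpolyXD; apply: supp_inX; right.
have kn : (k < n)%N by lia.
rewrite !mnmDE !mulmnE !mnm1E !inord0 // !inordK; try lia.
have -> : (ord0 == inord h :> 'I_n) = false by rewrite eq_sym inord0 /=; lia.
have -> : (ord0 == inord h.+1 :> 'I_n) = false by rewrite eq_sym inord0 /=; lia.
rewrite eqxx !addn0 (_ : (k == ord0 :> nat) = false); last by rewrite /=; lia.
have [->|kh] := eqVneq k h; first by rewrite mul1n divnn b_gt0.
rewrite (_ : k = h.+1); last by lia.
by rewrite eqxx mul1n divnn b_gt0 addnC !mul0n div0n.
Qed.

Lemma t_tdvd p : tdvd ord0 1 (p * t).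
Proof. by apply: tdvd_mull; apply/tdvdP; exists 1; rewrite mulr1. Qed.

Lemma twisted_y2 : exists q, tdvd ord0 e (phi q
    - (y1 ^+ b) ^+ (e - 2) * y2 ^+ b * t ^+ e.-1).
Proof.
(* [x_0 ^ (e - 2) * x_1] maps to the wanted element plus a multiple of [t ^ (e - 2) * u], which
   vanishes modulo [t ^ e]. *)
exists (t ^+ (e - 2) * 'X_(inord 1)).
rewrite rmorphM rmorphXn /= !substX /twisted_variable inordK /=; last by lia.
rewrite leqNgt (ltnW h_gt1) /= leqNgt h_gt1 /=.
have -> : e.-1 = (e - 2).+1 by lia.
rewrite (_ : _ - _ = (y1 ^+ b) ^+ (e - 2) * (t ^+ (e - 2) * u)); last first.
  by rewrite exprMn exprS; ring.
apply: tdvd_mull; rewrite -[e in tdvd _ e _](subnK e_gt1); apply: tdvdM => //.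
by apply/tdvdP; exists 1; rewrite mulr1.
Qed.

Hypothesis bracketP : exists q, tdvd ord0 e (phi q
    - (y1 ^+ b) ^+ (e - 2) * F * t ^+ e.-1).

Lemma twist_of : twist K n' h b e c.
Proof.
apply: (@Twist _ _ _ _ _ _ twisted_variable) => //.
- by rewrite !addnS.
- exact: ltnW.
- move=> i ih; rewrite /twisted_variable leqNgt ih /=.
  case: eqP => _; first by apply: corner_weighted; lia.
  case: eqP => _; first by apply: supp_inD => //; apply: corner_weighted; lia.
  by case: eqP => // _; apply: supp_in0.
- move=> i ih; rewrite /twisted_variable leqNgt ih /=.
  case: eqP => _; first by apply: corner_balanced; lia.
  case: eqP => _; first by apply: supp_inD => //; apply: corner_balanced; lia.
  by case: eqP => // _; apply: supp_in0.
- move=> i ih; rewrite /twisted_variable leqNgt ih /=.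
  case: eqP => _; first exact: t_tdvd.
  case: eqP => _; first by apply: tdvdD; [apply: t_tdvd|apply: tdvd_weak u_tdvd].
  by case: eqP => // _ m _; rewrite mcoeff0.
- by rewrite /twisted_variable leqNgt (ltnW h_gt1).
- by move=> i ih; rewrite /twisted_variable ih.
exact: twisted_y2.
Qed.

End Image.

(** Homogeneity dictates the exponent of the [z_i]: [c = 1] for [k = 1], and [c = b] for [k = 2]. *)
Lemma bracket_weighted k : (c + b.-1 + k = 1 + b * k)%N ->
  supp_in (weighted h b 1) (F * t ^+ k).
Proof.
move=> ck; rewrite mulr_suml; apply: supp_in_sum => i _.
rewrite !mpolyXn -!mpolyXD; apply: supp_inX.
have ib := ltn_ord i.
have inordE l (j : 'I_n) : (l < n)%N -> (inord l == j) = (l == j).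
  by move=> ln; rewrite -val_eqE /= inordK.
split=> [|j /andP[j0 jh]]; rewrite !mnmDE !mulmnE !mnm1E !inordE; try lia.
  rewrite !mdegD !mdegMn !mdeg1 eqxx /=.
  rewrite (_ : (h == 0%N) = false); last by lia.
  rewrite !mul0n !mul1n; lia.
rewrite [ord0 == j]eq_sym -val_eqE /=; lia.
Qed.

Lemma bracket_balanced k : supp_in (balanced h b c) (F * t ^+ k).
Proof.
rewrite mulr_suml; apply: supp_in_sum => i _.
rewrite !mpolyXn -!mpolyXD; apply: supp_inX; left.
have ib := ltn_ord i.
exists (inord (h.+2 + i)); first by rewrite inordK; lia.
by rewrite !mnmDE !mulmnE !mnm1E eqxx mul1n -!addnA leq_addr.
Qed.

End Instances.

Lemma exists_twist (K : fieldType) (h b e : nat) :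
  (1 < h)%N -> (0 < b)%N -> (1 < e)%N -> (h, e) <> (2%N, 2%N) ->
  exists n' c, inhabited (twist K n' h b e c).
Proof.
move=> h1 b0 e1 he; exists (h + b).+1.
have [e2|e_neq2] := eqVneq e 2%N.
  (* The excluded pair is what guarantees the variable [x_2] when [e = 2]. *)
  have h2 : (2 < h)%N.
    by rewrite ltn_neqAle h1 andbT; apply/eqP => h2; apply: he; rewrite -h2 e2.
  exists 1%N; pose t : {mpoly K[(h + b).+2]} := 'X_ord0.
  pose F := bracket K (h + b).+1 h b 1.
  constructor; apply: (@twist_of K h b e 1 h1 b0 isT e1 0 (F * t ^+ 1)).
  - exact: supp_in0.
  - by apply: bracket_weighted => //; lia.
  - exact: supp_in0.
  - exact: bracket_balanced.
  - by move=> m _; rewrite mcoeff0.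
  - exact: t_tdvd.
  exists 'X_(inord 2); rewrite e2 substX /twisted_variable inordK /=; last by lia.
  by rewrite leqNgt h2 /= expr0 mul1r subrr => m _; rewrite mcoeff0.
have e3 : (2 < e)%N by lia.
exists b; pose t : {mpoly K[(h + b).+2]} := 'X_ord0.
pose F := bracket K (h + b).+1 h b b.
constructor; apply: (@twist_of K h b e b h1 b0 b0 e1 (F * t ^+ 2) 0).
- by apply: bracket_weighted => //; lia.
- exact: supp_in0.
- exact: bracket_balanced.
- exact: supp_in0.
- by apply: tdvd_mull; apply/tdvdP; exists 1; rewrite mulr1.
- by move=> m _; rewrite mcoeff0.
pose f : {mpoly K[(h + b).+2]} := 'X_(inord h) ^+ b.
pose g : {mpoly K[(h + b).+2]} := 'X_(inord h.+1) ^+ b.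
(* The combination [f * x_1 - g * x_0] cancels [f * g * t] and leaves [f * F * t ^ 2]; the power of
   [x_0] supplies the rest. *)
exists (t ^+ (e - 3) * (f * 'X_(inord 1) - g * t)).
rewrite rmorphM rmorphXn rmorphB !rmorphM !rmorphXn /= !substX /twisted_variable.
rewrite !inordK /=; try lia.
rewrite leqnn leqnSn (leqNgt h 0) (ltnW h1) /= (leqNgt h 1) h1 /=.
have -> : (e - 2 = (e - 3).+1)%N by lia.
have -> : (e.-1 = (e - 3).+2)%N by lia.
rewrite (_ : _ - _ = 0) => [m _|]; first by rewrite mcoeff0.
by rewrite -/t -/F exprMn !exprS expr0; ring.
Qed.

Theorem theorem1p2 (K : closedFieldType) (h e p : nat) :
  (2 <= h)%N -> (2 <= e)%N -> (h, e) <> (2%N, 2%N) -> (5 <= p)%N ->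
  exists (n : nat) (I : ideal {mpoly K[n]}),
    homogeneous_ideal I /\
    unmixed I /\
    has_height I h /\
    has_multiplicity I e /\
    linear_prime (radical I) /\
    pd_ge (quot_ring_mod I) p.
Proof.
move=> h2 e2 he p5.
have p0 : (0 < p)%N by lia.
(* Taking [b = p] gives projective dimension at least [p.+1]. *)
have [n' [c [D]]] := exists_twist K h2 p0 e2 he.
exists n'.+1, (twist_ideal D); split; first exact: twist_homogeneous.
split; first exact: twist_unmixed.
split; first exact: has_height_twist.
split; first exact: twist_multiplicity.
split; first exact: twist_linear_prime.
by move=> d /(pd_ge_twist (D := D)); apply: ltnW.
Qed.
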